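(* For any integer $m\ge1$ there exist positive constants $c_m\le 8\log2+5\log m$ and $d_m\le 2m^3$, with $d_m$ an integer, such that the following holds. Suppose $\rho:\Gamma\to\mathrm{PSL}_m(\mathbb R)$ and $\tau:\Gamma\to\mathrm{PSL}_k(\mathbb R)$ are projective Anosov representations (with $m$ not necessarily equal to $k$). Then there exists $\beta>1$ depending only on $\tau$ such that if $L>d_m\beta$ then $$\operatorname{Dil}(\rho,\tau)\le\frac{c_md_m}{L-d_m\beta}+\left(\sup_{0<\log\lambda_1(\tau(g))\le L}\frac{\log\lambda_1(\rho(g))}{\log\lambda_1(\tau(g))}\right)\cdot\left(\frac{L}{L-d_m\beta}\right),$$ where the supremum is over conjugacy classes $[g]$ of $\Gamma$ with $0<\log\lambda_1(\tau(g))\le L$.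
   Context: For a matrix $A$, $\sigma_i(A)$ is its $i$-th largest singular value and $\lambda_1(A)$ its spectral radius; both are well defined for elements of $\mathrm{PSL}_m(\mathbb R)$. A representation $\rho:\Gamma\to\mathrm{PSL}_m(\mathbb R)$ of a finitely generated group is projective Anosov (equivalently, $1$-dominated) if, given a finite generating set $S$ of $\Gamma$ with word length $|\cdot|_S$, there exist $C,\mu>0$ such that $\frac{\sigma_1(\rho(g))}{\sigma_2(\rho(g))}\ge Ce^{\mu|g|_S}$ for all $g\in\Gamma$. Let $\mathbf{conj}'$ be the set of conjugacy classes of non-torsion elements of $\Gamma$. The dilation is $$\operatorname{Dil}(\rho,\tau):=\sup_{[g]\in\mathbf{conj}'}\frac{\log\lambda_1(\rho(g))}{\log\lambda_1(\tau(g))}.$$ Suprema are taken in $[0,\infty]$ (supremum of the empty set is $0$). *)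

(* Defs.v *)
From HB Require Import structures.
From mathcomp Require Import all_boot all_order all_algebra.
From mathcomp Require Import complex.
From mathcomp Require Import all_classical all_reals all_analysis.

Set Implicit Arguments.
Unset Strict Implicit.
Unset Printing Implicit Defensive.

Import Order.TTheory GRing.Theory Num.Theory.
Local Open Scope classical_set_scope.
Local Open Scope quotient_scope.
Local Open Scope ring_scope.

Record SL (R : realType) (m : nat) := MkSL {
  SL_mx :> 'M[R]_m;
  SL_det : \det SL_mx == 1 }.

HB.instance Definition _ (R : realType) (m : nat) := [isSub for @SL_mx R m].
HB.instance Definition _ (R : realType) (m : nat) := [Choice of SL R m by <:].

Section PSL.
Variables (R : realType) (m : nat).
Implicit Types A B C : SL R m.

Lemma detSL A : \det A = 1.
Proof. exact/eqP/SL_det. Qed.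

Lemma unitSL A : (A : 'M[R]_m) \in unitmx.
Proof. by rewrite unitmxE detSL unitr1. Qed.

Fact SL_one_subproof : \det (1%:M : 'M[R]_m) == 1.
Proof. by rewrite det1. Qed.
Fact SL_mul_subproof A B : \det (A *m B) == 1.
Proof. by rewrite det_mulmx !detSL mulr1. Qed.
Fact SL_inv_subproof A : \det (invmx A) == 1.
Proof. by rewrite det_inv detSL invr1. Qed.

Definition SL_one : SL R m := MkSL SL_one_subproof.
Definition SL_mul A B : SL R m := MkSL (SL_mul_subproof A B).
Definition SL_inv A : SL R m := MkSL (SL_inv_subproof A).

Fact SL_mulA : associative SL_mul.
Proof. by move=> A B C; apply: val_inj; rewrite /= mulmxA. Qed.
Fact SL_mul1 : left_id SL_one SL_mul.
Proof. by move=> A; apply: val_inj; rewrite /= mul1mx. Qed.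
Fact SL_mulr1 : right_id SL_one SL_mul.
Proof. by move=> A; apply: val_inj; rewrite /= mulmx1. Qed.
Fact SL_mulV : left_inverse SL_one SL_inv SL_mul.
Proof. by move=> A; apply: val_inj; rewrite /= mulVmx ?unitSL. Qed.
Fact SL_mulrV : right_inverse SL_one SL_inv SL_mul.
Proof. by move=> A; apply: val_inj; rewrite /= mulmxV ?unitSL. Qed.

HB.instance Definition _ :=
  isGroup.Build (SL R m) SL_mulA SL_mul1 SL_mulr1 SL_mulV SL_mulrV.

Lemma SL_mxM A B : SL_mx (A * B)%g = A *m B. Proof. by []. Qed.
Lemma SL_mxV A : SL_mx (A^-1)%g = invmx A. Proof. by []. Qed.

(* PSL_m(R) is the quotient of SL_m(R) by its centre, which consists of 1 and,
   when m is even, -1.  When m is odd, -B has determinant -1, so the second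
   disjunct never holds and the relation is equality. *)
Definition PSL_equiv A B : bool :=
  ((A : 'M[R]_m) == B) || ((A : 'M[R]_m) == - (B : 'M[R]_m)).

Lemma PSL_equiv_is_equiv : equiv_class_of PSL_equiv.
Proof.
split=> [A|A B|B A C]; rewrite /PSL_equiv.
- by rewrite eqxx.
- by rewrite eq_sym -eqr_oppLR [- _ == _]eq_sym.
- by case/orP=> /eqP ->; case/orP=> /eqP ->; rewrite ?opprK ?eqxx ?orbT.
Qed.

Canonical PSL_equiv_equiv := EquivRelPack PSL_equiv_is_equiv.

Definition PSL : Type := {eq_quot PSL_equiv}.

HB.instance Definition _ := Choice.on PSL.
HB.instance Definition _ := EqQuotient.on PSL.

Lemma PSL_eqP A B :
  \pi_PSL A = \pi_PSL B <->
  (A : 'M[R]_m) = B \/ (A : 'M[R]_m) = - (B : 'M[R]_m).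
Proof.
split=> [/eqP|H]; first by rewrite eqmodE => /orP[] /eqP; [left|right].
by apply/eqP; rewrite eqmodE; apply/orP; case: H => ->; [left|right].
Qed.

Lemma PSL_reprP A :
  (repr (\pi_PSL A) : 'M[R]_m) = A \/
  (repr (\pi_PSL A) : 'M[R]_m) = - (A : 'M[R]_m).
Proof. by apply/PSL_eqP; rewrite reprK. Qed.

Definition PSL_one : PSL := \pi_PSL SL_one.
Definition PSL_mul (x y : PSL) : PSL := \pi_PSL (SL_mul (repr x) (repr y)).
Definition PSL_inv (x : PSL) : PSL := \pi_PSL (SL_inv (repr x)).

Lemma PSL_mulE A B : PSL_mul (\pi A) (\pi B) = \pi_PSL (SL_mul A B).
Proof.
apply/PSL_eqP => /=; case: (PSL_reprP A) (PSL_reprP B) => -> [] ->.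
all: by rewrite ?mulNmx ?mulmxN ?opprK; auto.
Qed.

Lemma PSL_invE A : PSL_inv (\pi A) = \pi_PSL (SL_inv A).
Proof.
apply/PSL_eqP => /=; case: (PSL_reprP A) => ->; first by left.
right; apply: (can_inj (mulmxK (unitSL A))).
have uN : - (A : 'M[R]_m) \in unitmx.
  by rewrite -scaleN1r unitmxZ ?unitrN1 ?unitSL.
by rewrite mulNmx mulVmx ?unitSL // -[X in _ *m X = _]opprK mulmxN mulVmx.
Qed.

Fact PSL_mulA : associative PSL_mul.
Proof.
by elim/quotW=> A; elim/quotW=> B; elim/quotW=> C; rewrite !PSL_mulE SL_mulA.
Qed.
Fact PSL_mul1 : left_id PSL_one PSL_mul.
Proof. by elim/quotW=> A; rewrite PSL_mulE SL_mul1. Qed.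
Fact PSL_mulr1 : right_id PSL_one PSL_mul.
Proof. by elim/quotW=> A; rewrite PSL_mulE SL_mulr1. Qed.
Fact PSL_mulV : left_inverse PSL_one PSL_inv PSL_mul.
Proof. by elim/quotW=> A; rewrite PSL_invE PSL_mulE SL_mulV. Qed.
Fact PSL_mulrV : right_inverse PSL_one PSL_inv PSL_mul.
Proof. by elim/quotW=> A; rewrite PSL_invE PSL_mulE SL_mulrV. Qed.

HB.instance Definition _ :=
  isGroup.Build PSL PSL_mulA PSL_mul1 PSL_mulr1 PSL_mulV PSL_mulrV.

Lemma PSL_pi_mul A B : \pi_PSL (A * B)%g = (\pi_PSL A * \pi_PSL B)%g.
Proof. by rewrite [RHS]PSL_mulE. Qed.

Lemma PSL_pi_inv A : \pi_PSL (A^-1)%g = ((\pi_PSL A)^-1)%g.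
Proof. by rewrite [RHS]PSL_invE. Qed.
End PSL.

Section SingularValues.
Variables (R : realType) (m : nat).
Implicit Types A : 'M[R]_m.

Definition complex_mx A : 'M[R[i]]_m := map_mx (real_complex R) A.

(* The complex eigenvalues of A, listed with algebraic multiplicity. *)
Definition spectrum A : seq R[i] :=
  projT1 (closed_field_poly_normal (char_poly (complex_mx A))).

Lemma char_poly_spectrum A :
  char_poly (complex_mx A) = \prod_(z <- spectrum A) ('X - z%:P).
Proof.
rewrite /spectrum; case: closed_field_poly_normal => /= s {1}->.
by rewrite (monicP (char_poly_monic _)) scale1r.
Qed.

(* The eigenvalues of A^T *m A are real, so that Re only changes their type. *)
Definition singular_values A : seq R :=
  sort >=%R [seq Num.sqrt (complex.Re z) | z <- spectrum (A^T *m A)].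

(* Indices start at 1, and the value is 0 when i > m. *)
Definition singular_value (i : nat) A : R := nth 0 (singular_values A) i.-1.

Definition eigenvalue_moduli A : set R :=
  [set ComplexField.Normc.normc z | z in [set z | eigenvalue (complex_mx A) z]].

Definition spectral_radius A : R := sup (eigenvalue_moduli A).

Lemma singular_valueN i A : singular_value i (- A) = singular_value i A.
Proof.
rewrite /singular_value /singular_values.
have -> : (- A)^T = - A^T by apply/matrixP => j l; rewrite !mxE.
by rewrite mulNmx mulmxN opprK.
Qed.

Lemma spectral_radiusN A : spectral_radius (- A) = spectral_radius A.
Proof.
have sub B : eigenvalue_moduli (- B) `<=` eigenvalue_moduli B.
  move=> _ [z /= /eigenvalueP[v vz v0] <-]; exists (- z);
    last by rewrite normcN.
  apply/eigenvalueP; exists v => //.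
  apply/eqP; rewrite scaleNr -vz /complex_mx raddfN /= mulmxN opprK.
  exact/eqP.
have E : eigenvalue_moduli (- A) = eigenvalue_moduli A.
  rewrite eqEsubset; split; first exact: sub.
  by have := sub (- A); rewrite opprK.
by rewrite /spectral_radius E.
Qed.

Lemma spectral_radius_conj A B :
  B \in unitmx -> spectral_radius (invmx B *m (A *m B)) = spectral_radius A.
Proof.
have sub C D : D \in unitmx ->
    eigenvalue_moduli C `<=` eigenvalue_moduli (invmx D *m (C *m D)).
  move=> uD _ [z /= /eigenvalueP[v vz v0] <-]; exists z => //=.
  have uDC : complex_mx D \in unitmx by rewrite map_unitmx.
  apply/eigenvalueP; exists (v *m complex_mx D).
    rewrite /complex_mx !map_mxM map_invmx -!/(complex_mx _).
    by rewrite !mulmxA mulmxK // vz scalemxAl.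
  by apply: contra v0 => /eqP vD; rewrite -[v](mulmxK uDC) vD mul0mx.
move=> uB.
have E : eigenvalue_moduli (invmx B *m (A *m B)) = eigenvalue_moduli A.
  rewrite eqEsubset; split; last exact: sub.
  have := sub (invmx B *m (A *m B)) (invmx B).
  by rewrite unitmx_inv uB invmxK -!mulmxA mulmxV // mulmx1 mulKVmx //; apply.
by rewrite /spectral_radius E.
Qed.
End SingularValues.

Definition sigma (R : realType) (m : nat) (i : nat) (x : PSL R m) : R :=
  singular_value i (repr x : 'M[R]_m).

Definition lambda1 (R : realType) (m : nat) (x : PSL R m) : R :=
  spectral_radius (repr x : 'M[R]_m).

Lemma sigma_pi (R : realType) (m i : nat) (A : SL R m) :
  sigma i (\pi_(PSL R m) A) = singular_value i (A : 'M[R]_m).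
Proof.
by rewrite /sigma; case: (PSL_reprP A) => ->; rewrite ?singular_valueN.
Qed.

Lemma lambda1_pi (R : realType) (m : nat) (A : SL R m) :
  lambda1 (\pi_(PSL R m) A) = spectral_radius (A : 'M[R]_m).
Proof.
by rewrite /lambda1; case: (PSL_reprP A) => ->; rewrite ?spectral_radiusN.
Qed.

Lemma lambda1_conj (R : realType) (m : nat) (x y : PSL R m) :
  lambda1 (x ^ y)%g = lambda1 x.
Proof.
elim/quotW: x => A; elim/quotW: y => B.
rewrite conjgE -PSL_pi_inv -(PSL_pi_mul A) -PSL_pi_mul !lambda1_pi.
rewrite !SL_mxM SL_mxV.
exact: spectral_radius_conj (unitSL B).
Qed.

Section Groups.
Variable Gamma : groupType.

Definition torsion (g : Gamma) : Prop :=
  exists2 n, (0 < n)%N & (g ^+ n)%g = 1%g.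

Definition conj_class (g : Gamma) : set Gamma := range (fun h => (g ^ h)%g).

Definition conj' : set (set Gamma) :=
  [set conj_class g | g in [set g | ~ torsion g]].

Definition is_word (S : seq Gamma) (g : Gamma) (n : nat) : Prop :=
  exists w : seq Gamma,
    [/\ size w = n, {in w, forall s, s \in S \/ (s^-1)%g \in S}
      & g = (\prod_(s <- w) s)%g].

Definition generates (S : seq Gamma) : Prop :=
  forall g, exists n, is_word S g n.

Definition finitely_generated : Prop := exists S, generates S.

(* The least length of a word representing g; it is only meaningful when g is
   represented by some word, the default value 0 being used otherwise. *)
Definition word_length (S : seq Gamma) (g : Gamma) : nat :=
  xget 0%N [set n | is_word S g n /\ forall k, is_word S g k -> (n <= k)%N].
End Groups.

Notation representation R Gamma m :=
  (UMagmaMorphism.type Gamma (PSL R m)).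

(* The second singular value only exists when m >= 2, hence the first clause
   (p-domination makes sense for 1 <= p <= m - 1). *)
Definition projective_anosov (R : realType) (Gamma : groupType) (m : nat)
    (rho : representation R Gamma m) : Prop :=
  (2 <= m)%N /\
  forall S : seq Gamma, generates S ->
    exists C mu : R, [/\ 0 < C, 0 < mu &
      forall g, sigma 1 (rho g) / sigma 2 (rho g)
                >= C * expR (mu * (word_length S g)%:R)].

Section Dilation.
Variables (R : realType) (Gamma : groupType) (m k : nat).
Variables (rho : representation R Gamma m).
Variables (tau : representation R Gamma k).

Definition log_ratio (g : Gamma) : R :=
  ln (lambda1 (rho g)) / ln (lambda1 (tau g)).

Lemma log_ratio_conj g h : log_ratio (g ^ h)%g = log_ratio g.
Proof. by rewrite /log_ratio !gmulfJ !lambda1_conj. Qed.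

(* Supremum in [0, +oo], so that the supremum of set0 is 0. *)
Definition sup_nneg (A : set R) : \bar R := ereal_sup (0%E |` (EFin @` A)).

(* By log_ratio_conj, suprema over conjugacy classes [g] of log_ratio g are
   taken by letting g range over the elements of these classes. *)
Definition Dil : \bar R :=
  sup_nneg [set log_ratio g | g in [set g | conj' (conj_class g)]].

Definition Dil_upto (L : R) : \bar R :=
  sup_nneg [set log_ratio g | g in [set g | 0 < ln (lambda1 (tau g)) <= L]].
End Dilation.

(* Main.v *)
Require Import Defs.
From HB Require Import structures.
From mathcomp Require Import all_boot all_order all_algebra.
From mathcomp Require Import perm complex sesquilinear spectral ring lra zify.
From mathcomp Require Import all_classical all_reals all_analysis.

Set Implicit Arguments.
Unset Strict Implicit.
Unset Printing Implicit Defensive.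

Import Order.TTheory GRing.Theory Num.Theory.
Local Open Scope ring_scope.

(** The comparison rests on two facts of a different nature.

    The first one is an inequality of Bochi, in a version with constants
    polynomial in the dimension (words_grow_of_traces): if the products of at
    most 2 m^3 elements of a bounded set of m x m matrices have the traces that
    eigenvalues of modulus at most M^j would give them, j being the length, then
    all products of N elements are O((256 m^5 M)^N).  For a norm adapted to the
    joint growth rate, some long product hardly shrinks some vector.  Among the
    successive images of this vector, one is almost a combination, with controlled
    coefficients, of its own images by short products (controlled_combination).
    A combination X of short products thus almost fixes a vector.  But the traces
    of the powers of X are small, and so are the coefficients of its
    characteristic polynomial by Newton's identities, which contradicts the
    Cayley-Hamilton theorem (almost_fixed_contradiction).

    The second one is that for a projective Anosov representation tau the
    logarithm of the operator norm is additive along geodesic words, up to a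
    bounded error at each cut (anosov_quasi_additive).  The gaps between the
    first two singular values of all subwords make the directions that they
    expand most, and the images of these, converge exponentially fast; the error
    at a cut then only depends on the neighbourhood of the cut, and a large error
    at one cut would propagate to many cuts and make the norm of some subword
    smaller than 1, which the determinant forbids
    (dominated_chain_quasi_multiplicative).

    Given r, a geodesic word of g^n is therefore a product of elements h with
    log |tau h| <= r, in a number which is about log |tau (g^n)| / (r - beta)
    (anosov_pieces).  With r = L / d, a product of at most d such elements has an
    image under tau with norm at most e^L, so that the supremum over the short
    elements bounds its eigenvalues under rho.  The inequality of Bochi then
    bounds the growth of rho on such products, hence |rho (g^n)|, and letting n
    tend to infinity compares the eigenvalues of rho g and tau g
    (dilation_of_growth, log_lambda_bound). *)

(** * Newton's identities and the characteristic polynomial *)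

Section Newton.
Variable F : comNzRingType.
Implicit Types (xs : seq F) (k : nat).

Definition power_sum xs k : F := \sum_(x <- xs) x ^+ k.

(** Its coefficient of degree [k] is, up to sign, the [k]-th elementary symmetric
    function of [xs]; contrary to the coefficients of the product of the
    ['X - x%:P], these keep their index when [xs] grows. *)
Definition reciprocal_poly xs : {poly F} := \prod_(x <- xs) (1 - x *: 'X).

Lemma coef_reciprocal_cons x xs k :
  (reciprocal_poly (x :: xs))`_k.+1 =
  (reciprocal_poly xs)`_k.+1 - x * (reciprocal_poly xs)`_k.
Proof.
by rewrite /reciprocal_poly big_cons mulrBl mul1r -scalerAl coefB coefZ coefXM.
Qed.

Lemma coef_reciprocal_cons0 x xs :
  (reciprocal_poly (x :: xs))`_0 = (reciprocal_poly xs)`_0.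
Proof.
rewrite /reciprocal_poly big_cons mulrBl mul1r -scalerAl coefB coefZ coefXM.
by rewrite eqxx mulr0 subr0.
Qed.

(** By induction on [xs]: a new element [x] multiplies the reciprocal polynomial
    by [1 - x *: 'X], and the new terms of the sum telescope. *)
Lemma newton_identity xs k :
  (reciprocal_poly xs)`_k *+ k +
  \sum_(i < k) (reciprocal_poly xs)`_(k.-1 - i) * power_sum xs i.+1 = 0.
Proof.
elim: xs k => [|x xs IH] [|k] /=; rewrite ?big_ord0 ?mulr0n ?addr0 //.
  rewrite /reciprocal_poly big_nil coef1 /= mul0rn add0r big1 // => i _.
  by rewrite /power_sum big_nil mulr0.
set e := fun k => (reciprocal_poly xs)`_k.
set e' := fun k => (reciprocal_poly (x :: xs))`_k.
set p := power_sum xs.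
have pE i : power_sum (x :: xs) i = x ^+ i + p i.
  by rewrite /power_sum big_cons.
have IH1 := IH k.+1; have IH0 := IH k.
rewrite -/p -/(e k.+1) /= in IH1; rewrite -/p -/(e k) in IH0.
have -> : (reciprocal_poly (x :: xs))`_k.+1 = e k.+1 - x * e k.
  exact: coef_reciprocal_cons.
have -> : \sum_(i < k.+1) (reciprocal_poly (x :: xs))`_(k - i) *
    power_sum (x :: xs) i.+1 =
  \sum_(i < k.+1) e (k - i)%N * p i.+1 +
  (\sum_(i < k.+1) e (k - i)%N * x ^+ i.+1) -
  x * (\sum_(i < k) e (k.-1 - i)%N * p i.+1) -
  x * (\sum_(i < k) e (k.-1 - i)%N * x ^+ i.+1).
  rewrite big_ord_recr [in RHS]big_ord_recr /= [X in _ + X - _ - _]big_ord_recr /=.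
  rewrite subnn coef_reciprocal_cons0 pE -/(e 0%N).
  have -> : \sum_(i < k) (reciprocal_poly (x :: xs))`_(k - i) *
     power_sum (x :: xs) i.+1 = \sum_(i < k)
     (e (k - i)%N * p i.+1 + e (k - i)%N * x ^+ i.+1
      - x * (e (k.-1 - i)%N * p i.+1) - x * (e (k.-1 - i)%N * x ^+ i.+1)).
    apply: eq_bigr => i _; rewrite pE.
    have -> : (k - i = (k.-1 - i).+1)%N by have := ltn_ord i; lia.
    rewrite coef_reciprocal_cons /e.
    by rewrite [x ^+ _ + _]addrC mulrBl !mulrDr opprD !addrA !mulrA.
  by rewrite !big_split /= !sumrN -!mulr_sumr; ring.
have -> : \sum_(i < k.+1) e (k - i)%N * x ^+ i.+1 =
    e k * x + x * (\sum_(i < k) e (k.-1 - i)%N * x ^+ i.+1).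
  rewrite big_ord_recl /= subn0 expr1 mulr_sumr; congr (_ + _).
  apply: eq_bigr => i _; rewrite /bump /= add1n.
  have -> : (k - i.+1 = k.-1 - i)%N by lia.
  by rewrite [in LHS]exprS; ring.
move: IH1 IH0; rewrite mulrS.
set s1 := \sum_(i < k.+1) _; set s0 := \sum_(i < k) e _ * p _; set s2 := \sum_(i < k) _.
move=> IH1 IH0.
have -> : (e k.+1 - x * e k) *+ k.+1 + (s1 + (e k * x + x * s2) - x * s0 - x * s2)
  = (e k.+1 + e k.+1 *+ k + s1) - x * (e k *+ k + s0).
  by rewrite mulrS mulrnBl -[(x * e k) *+ k]mulrnAr; ring.
by rewrite IH1 IH0 mulr0 subr0.
Qed.

Lemma prod_XsubC_reciprocal xs :
  \prod_(x <- xs) ('X - x%:P) =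
  \sum_(k < (size xs).+1) (reciprocal_poly xs)`_k *: 'X^(size xs - k).
Proof.
elim: xs => [|x xs IH].
  by rewrite big_nil big_ord1 /reciprocal_poly big_nil coef1 scale1r expr0.
rewrite big_cons IH /= mulrBl.
rewrite [in RHS]big_ord_recl /= coef_reciprocal_cons0 subn0.
have -> : \sum_(i < (size xs).+1) (reciprocal_poly (x :: xs))`_(bump 0 i) *:
   'X^((size xs).+1 - bump 0 i) = \sum_(i < (size xs).+1)
   ((reciprocal_poly xs)`_i.+1 *: 'X^(size xs - i) -
    x *: ((reciprocal_poly xs)`_i *: 'X^(size xs - i))).
  apply: eq_bigr => i _; rewrite /bump add1n subSS coef_reciprocal_cons.
  by rewrite scalerBl scalerA.
rewrite big_split /= sumrN -scaler_sumr mul_polyC addrA; congr (_ - _).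
rewrite big_ord_recl /= mulrDr [in RHS]big_ord_recr /= subn0 subnn.
rewrite -[X in _ = _ + (_ + X)]/((reciprocal_poly xs)`_(size xs).+1 *: 1).
have -> : (reciprocal_poly xs)`_(size xs).+1 = 0.
  apply/leq_sizeP: (leqnn (size xs).+1).
  rewrite /reciprocal_poly; elim: (xs) => [|y ys IHy] /=.
    by rewrite big_nil size_poly1.
  rewrite big_cons mulrBl mul1r -scalerAl.
  apply: leq_trans (size_polyD _ _) _; rewrite geq_max size_polyN.
  rewrite (leq_trans IHy) //=; apply: leq_trans (size_scale_leq _ _) _.
  by apply: leq_trans (size_polyMleq _ _) _; rewrite size_polyX.
rewrite scale0r addr0 -scalerAr -exprS; congr (_ + _).
rewrite mulr_sumr; apply: eq_bigr => i _; rewrite /bump add1n -scalerAr -exprS.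
by congr (_ *: 'X^_); have := ltn_ord i; lia.
Qed.
End Newton.

Lemma char_poly_invmx_conj (F : comUnitRingType) n (P T : 'M[F]_n) : P \in unitmx ->
  char_poly (invmx P *m T *m P) = char_poly T.
Proof.
move=> Punit; rewrite /char_poly /char_poly_mx.
have -> : 'X%:M - map_mx polyC (invmx P *m T *m P) =
    map_mx polyC (invmx P) *m ('X%:M - map_mx polyC T) *m map_mx polyC P.
  rewrite mulmxBr mulmxBl !map_mxM; congr (_ - _).
  by rewrite scalar_mxC -mulmxA -map_mxM mulVmx // map_mx1 mulmx1.
by rewrite !det_mulmx mulrAC -det_mulmx -map_mxM mulVmx // map_mx1 det1 mul1r.
Qed.

Section ComplexTraces.
Variable C : numClosedFieldType.

Lemma trig_expr n (T : 'M[C]_n.+1) k : is_trig_mx T ->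
  is_trig_mx (T ^+ k) /\ forall i, (T ^+ k) i i = T i i ^+ k.
Proof.
move=> /is_trig_mxP tT; elim: k => [|k [/is_trig_mxP IH1 IH2]].
  split; last by move=> i; rewrite !expr0 mxE eqxx.
  by rewrite expr0 scalar_mx_is_trig.
split=> [|i]; last first.
  rewrite !exprS mxE (bigD1 i) //= IH2 big1 ?addr0 // => j ji.
  case: (ltngtP i j) => [lij|lji|/val_inj eij]; first by rewrite tT ?mul0r.
    by rewrite IH1 ?mulr0.
  by rewrite eij eqxx in ji.
apply/is_trig_mxP => i j lij; rewrite exprS mxE big1 // => l _.
case: (leqP l i) => li; last by rewrite tT ?mul0r.
by rewrite IH1 ?mulr0 // (leq_ltn_trans li).
Qed.

(** Over an algebraically closed field a matrix is conjugate to a triangular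
    one, and the diagonal of the powers of the latter is explicit. *)
Lemma char_poly_power_sums n (A : 'M[C]_n.+1) :
  exists xs : seq C, [/\ size xs = n.+1,
    char_poly A = \prod_(x <- xs) ('X - x%:P)
    & forall k, \tr (A ^+ k) = power_sum xs k].
Proof.
have [P Pu] := Schur A (ltn0Sn n).
rewrite /similar_to => tT.
have Punit : P \in unitmx by apply: unitarymx_unit.
have defT := conjumx A Punit.
set T := conjmx P A in tT defT.
have AE : A = invmx P *m T *m P.
  by rewrite defT !mulmxA mulVmx // mul1mx mulmxKV.
have AXE k : A ^+ k = invmx P *m (T ^+ k) *m P.
  elim: k => [|k IHk]; first by rewrite !expr0 mulmx1 mulVmx.
  rewrite !exprS IHk {1}AE -!mulmxE !mulmxA.
  by congr (_ *m _); rewrite mulmxK.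
exists [seq T i i | i <- enum 'I_n.+1]; split.
- by rewrite size_map size_enum_ord.
- by rewrite big_map big_enum /= -char_poly_trig // AE char_poly_invmx_conj.
- move=> k; rewrite AXE mxtrace_mulC mulmxA mulmxV // mul1mx /power_sum.
  rewrite big_map big_enum /= /mxtrace; apply: eq_bigr => i _.
  by rewrite (trig_expr k tT).2.
Qed.
End ComplexTraces.

(** * The entrywise l1 norm *)

Section L1Norm.
Variable F : numDomainType.

Definition l1 m n (A : 'M[F]_(m, n)) : F := \sum_i \sum_j `|A i j|.

Lemma l1_ge0 m n (A : 'M[F]_(m, n)) : 0 <= l1 A.
Proof. by apply: sumr_ge0 => i _; apply: sumr_ge0. Qed.

Lemma l1D m n (A B : 'M[F]_(m, n)) : l1 (A + B) <= l1 A + l1 B.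
Proof.
rewrite -big_split; apply: ler_sum => i _; rewrite -big_split.
by apply: ler_sum => j _; rewrite mxE ler_normD.
Qed.

Lemma l1Z m n a (A : 'M[F]_(m, n)) : l1 (a *: A) = `|a| * l1 A.
Proof.
rewrite /l1 mulr_sumr; apply: eq_bigr => i _.
by rewrite mulr_sumr; apply: eq_bigr => j _; rewrite mxE normrM.
Qed.

Lemma l1_entry m n (A : 'M[F]_(m, n)) i j : `|A i j| <= l1 A.
Proof.
rewrite /l1 (bigD1 i) //= (bigD1 j) //= -addrA lerDl.
by apply: addr_ge0; apply: sumr_ge0 => // l _; apply: sumr_ge0.
Qed.

Lemma l1M m n p (A : 'M[F]_(m, n)) (B : 'M[F]_(n, p)) :
  l1 (A *m B) <= l1 A * l1 B.
Proof.
have step : l1 (A *m B) <= \sum_i \sum_k `|A i k| * \sum_j `|B k j|.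
  rewrite /l1; apply: ler_sum => i _.
  under [leRHS]eq_bigr do rewrite mulr_sumr.
  rewrite exchange_big; apply: ler_sum => j _; rewrite mxE.
  apply: le_trans (ler_norm_sum _ _ _) _; apply: ler_sum => k _.
  by rewrite normrM.
apply: le_trans step _; rewrite /l1 mulr_suml; apply: ler_sum => i _.
rewrite mulr_suml; apply: ler_sum => k _; apply: ler_wpM2l => //.
rewrite [leRHS](bigD1 k) //= lerDl.
by apply: sumr_ge0 => l _; apply: sumr_ge0.
Qed.

Lemma l1_eq0 m n (A : 'M[F]_(m, n)) : l1 A = 0 -> A = 0.
Proof.
move=> A0; apply/matrixP => i j; rewrite mxE; apply/eqP.
by rewrite -normr_le0 -A0 l1_entry.
Qed.

Lemma l1_eigenvalue n (A : 'M[F]_n) v z :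
  v *m A = z *: v -> v != 0 :> 'rV_n -> `|z| <= l1 A.
Proof.
move=> vA v0; have vp : 0 < l1 v.
  by rewrite lt_def l1_ge0 andbT; apply: contra v0 => /eqP/l1_eq0->.
by rewrite -(ler_pM2l vp) mulrC -l1Z -vA l1M.
Qed.
End L1Norm.

(** * Traces, eigenvalues and the spectral radius *)

Section RealMatrices.
Variables (R : realType) (n : nat).
Implicit Types A X : 'M[R]_n.+1.
Local Notation Cx := (@real_complex R).

Lemma normc_real_complex (x : R) : `|(x%:C)%C| = (`|x|%:C)%C.
Proof. by rewrite normc_def /= expr0n /= addr0 sqrtr_sqr. Qed.

Lemma complex_mxX A k : complex_mx (A ^+ k) = complex_mx A ^+ k.
Proof. by rewrite /complex_mx; apply: (rmorphXn (map_mx _)). Qed.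

Lemma trace_complex_mx A : \tr (complex_mx A) = ((\tr A)%:C)%C.
Proof. by rewrite /complex_mx trace_map_mx. Qed.

Lemma l1_complex_mx A : l1 (complex_mx A) = ((l1 A)%:C)%C.
Proof.
rewrite /l1 rmorph_sum; apply: eq_bigr => i _.
by rewrite rmorph_sum; apply: eq_bigr => j _; rewrite mxE normc_real_complex.
Qed.

(** If the traces of the powers of [X] are as small as if all its eigenvalues
    were at most [c] in modulus, Newton's identities bound the coefficients of
    the characteristic polynomial, and the Cayley-Hamilton theorem gives an
    equation for [X] with these coefficients. *)
Lemma small_traces_annihilator X (c : R) : 0 <= c ->
  (forall k, (0 < k <= n.+1)%N -> `|\tr (X ^+ k)| <= n.+1%:R * c ^+ k) ->
  exists e : nat -> R, [/\ e 0%N = 1,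
    forall k, (k <= n.+1)%N -> `|e k| <= (n.+1%:R * c) ^+ k &
    \sum_(k < n.+2) e k *: X ^+ (n.+1 - k) = 0].
Proof.
move=> c0 trX.
have [xs [szxs cpE trE]] := char_poly_power_sums (complex_mx X).
pose e k := (char_poly X)`_(n.+1 - k).
have eE k : (k <= n.+1)%N -> ((e k)%:C)%C = (reciprocal_poly xs)`_k.
  move=> lekn; rewrite /e -coef_map map_char_poly cpE prod_XsubC_reciprocal szxs.
  rewrite coef_sum (bigD1 (inord k)) //= inordK ?ltnS // coefZ coefXn eqxx.
  rewrite mulr1 big1 ?addr0 // => i ik; rewrite coefZ coefXn.
  case: eqP => [eqk|]; rewrite ?mulr0 //; move/eqP: ik; case.
  by apply/val_inj; rewrite /= inordK ?ltnS //; have := ltn_ord i; lia.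
exists e; split.
- by rewrite /e subn0; have /monicP := char_poly_monic X;
    rewrite lead_coefE size_char_poly.
- move=> k; elim/ltn_ind: k => -[|k] IH lek.
    by rewrite expr0 /e subn0; have /monicP := char_poly_monic X;
      rewrite lead_coefE size_char_poly => ->; rewrite normr1.
  have := newton_identity xs k.+1; rewrite -eE //=.
  have -> : \sum_(i < k.+1) (reciprocal_poly xs)`_(k - i) * power_sum xs i.+1 =
     ((\sum_(i < k.+1) e (k - i)%N * \tr (X ^+ i.+1))%:C)%C.
    rewrite rmorph_sum; apply: eq_bigr => i _ /=.
    rewrite rmorphM /= eE; last by lia.
    by rewrite -trace_complex_mx complex_mxX trE.
  rewrite -rmorphMn -rmorphD => /complexI /addr0_eq eq_e.
  have {eq_e} : `|e k.+1| *+ k.+1 = `|\sum_(i < k.+1) e (k - i)%N * \tr (X ^+ i.+1)|.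
    by rewrite -eq_e normrN normrMn.
  move=> eq_e; rewrite -(ler_pMn2r (ltn0Sn k)) eq_e.
  apply: le_trans (ler_norm_sum _ _ _) _.
  have <- : \sum_(i < k.+1) (n.+1%:R * c) ^+ k.+1 = (n.+1%:R * c) ^+ k.+1 *+ k.+1.
    by rewrite sumr_const card_ord.
  apply: ler_sum => i _; have lik := ltn_ord i; rewrite normrM.
  have ki : (k - i < k.+1)%N by lia.
  apply: le_trans (ler_pM _ _ (IH _ ki _) (trX i.+1 _)) _ => //; try lia.
  have -> : (n.+1%:R * c) ^+ k.+1 = (n.+1%:R * c) ^+ (k - i) * (n.+1%:R ^+ i.+1 * c ^+ i.+1).
    by rewrite -[_ ^+ i.+1 * _]exprMn -exprD; congr (_ ^+ _); lia.
  apply: ler_wpM2l; first by apply: exprn_ge0; apply: mulr_ge0.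
  apply: ler_wpM2r; first exact: exprn_ge0.
  by rewrite exprS ler_peMr // exprn_ege1 // ler1n.
- have := Cayley_Hamilton X.
  rewrite -[char_poly X]coefK poly_def size_char_poly raddf_sum /= => cayley.
  rewrite -[RHS]cayley (reindex_inj rev_ord_inj) /=; apply: eq_bigr => i _.
  rewrite /e linearZ /= rmorphXn /= horner_mx_X.
  by congr (_`_ _ *: X ^+ _); have := ltn_ord i; lia.
Qed.

Lemma eigenvalue_moduli_normc A z : eigenvalue (complex_mx A) z ->
  ComplexField.Normc.normc z <= spectral_radius A.
Proof.
move=> ez; apply: ub_le_sup; last by exists z.
exists (l1 A) => _ [w /= /eigenvalueP[v vA v0] <-].
by rewrite -lecR -l1_complex_mx; apply: l1_eigenvalue vA v0.
Qed.

Lemma eigenvalue_exists A : exists z, eigenvalue (complex_mx A) z.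
Proof.
have [xs [szxs cpE _]] := char_poly_power_sums (complex_mx A).
case: xs szxs cpE => // z xs _ cpE; exists z.
by rewrite eigenvalue_root_char cpE big_cons rootM root_XsubC eqxx.
Qed.

Lemma spectral_radius_le A b :
  (forall z, eigenvalue (complex_mx A) z -> ComplexField.Normc.normc z <= b) ->
  spectral_radius A <= b.
Proof.
move=> bA; apply: ge_sup; last by move=> _ [z /= ez <-]; apply: bA.
by have [z ez] := eigenvalue_exists A; exists (ComplexField.Normc.normc z), z.
Qed.

Lemma spectral_radius_ge0 A : 0 <= spectral_radius A.
Proof.
have [z ez] := eigenvalue_exists A; apply: le_trans (eigenvalue_moduli_normc ez).
by case: z {ez} => a b; apply: sqrtr_ge0.
Qed.

Lemma norm_normc (z : R[i]) : `|z| = ((ComplexField.Normc.normc z)%:C)%C.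
Proof. by []. Qed.

Lemma normc_expr (z : R[i]) k :
  ComplexField.Normc.normc (z ^+ k) = ComplexField.Normc.normc z ^+ k.
Proof. by apply: (@complexI R); rewrite rmorphXn /= -!norm_normc normrX. Qed.

Lemma spectral_radius_attained A : exists2 z,
  eigenvalue (complex_mx A) z & ComplexField.Normc.normc z = spectral_radius A.
Proof.
have [xs [szxs cpE _]] := char_poly_power_sums (complex_mx A).
have eE z : eigenvalue (complex_mx A) z = (z \in xs).
  by rewrite eigenvalue_root_char cpE root_prod_XsubC.
have [z zxs zmax] : exists2 z, z \in xs & forall y, y \in xs ->
    ComplexField.Normc.normc y <= ComplexField.Normc.normc z.
  have : xs != [::] by case: xs szxs {cpE eE}.
  elim: xs {szxs cpE eE} => // x xs IH _; have [->|/IH[z zxs zmax]] := eqVneq xs [::].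
    by exists x; rewrite ?mem_head // => y; rewrite inE => /eqP->.
  case: (leP (ComplexField.Normc.normc x) (ComplexField.Normc.normc z)) => [xz|zx].
    by exists z => [|y]; rewrite inE ?zxs ?orbT // => /predU1P[->|/zmax].
  exists x => [|y]; rewrite ?mem_head // inE => /predU1P[->//|/zmax yz].
  exact: le_trans yz (ltW zx).
exists z; rewrite ?eE //; apply/le_anti/andP; split.
  by apply: eigenvalue_moduli_normc; rewrite eE.
by apply: spectral_radius_le => y; rewrite eE; apply: zmax.
Qed.

Lemma spectral_radius_expr A k : spectral_radius A ^+ k <= l1 (A ^+ k).
Proof.
have [z /eigenvalueP[v vA v0] <-] := spectral_radius_attained A.
rewrite -normc_expr -lecR -norm_normc -l1_complex_mx complex_mxX.
apply: l1_eigenvalue v0; elim: k => [|k IH]; first by rewrite !expr0 mulmx1 scale1r.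
by rewrite !exprS -mulmxE mulmxA vA -scalemxAl IH scalerA.
Qed.

Lemma trace_power_spectral_radius A k :
  `|\tr (A ^+ k)| <= n.+1%:R * spectral_radius A ^+ k.
Proof.
have [xs [szxs cpE trE]] := char_poly_power_sums (complex_mx A).
rewrite -lecR -normc_real_complex -trace_complex_mx complex_mxX trE.
apply: le_trans (ler_norm_sum _ _ _) _.
rewrite rmorphM rmorphXn /= rmorph_nat mulr_natl.
set r := ((spectral_radius A)%:C)%C; rewrite -szxs.
have -> : r ^+ k *+ size xs = \sum_(x <- xs) r ^+ k.
  by rewrite big_const_seq count_predT iter_addr_0.
rewrite big_seq [leRHS]big_seq; apply: ler_sum => x xin.
rewrite normrX /r lerXn2r // ?nnegrE ?lecR ?spectral_radius_ge0 //.
apply: eigenvalue_moduli_normc.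
by rewrite eigenvalue_root_char cpE root_prod_XsubC.
Qed.

End RealMatrices.

(** * Bases of controlled volume *)

Section Norms.
Variables (R : realType) (n : nat).
Local Notation m := n.+1.

(** A norm on row vectors; the last clause replaces the equivalence of norms
    in finite dimension. *)
Definition is_norm (nu : 'rV[R]_m -> R) :=
  [/\ forall u v, nu (u + v) <= nu u + nu v,
      forall a v, nu (a *: v) = `|a| * nu v &
      exists k, forall v, l1 v <= k * nu v].

Variable nu : 'rV[R]_m -> R.
Hypothesis nuP : is_norm nu.

Lemma is_normD u v : nu (u + v) <= nu u + nu v.
Proof. by case: nuP. Qed.

Lemma is_normZ a v : nu (a *: v) = `|a| * nu v.
Proof. by case: nuP. Qed.

Lemma is_norm0 : nu 0 = 0.
Proof. by rewrite -[X in nu X](scale0r 0) is_normZ normr0 mul0r. Qed.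

Lemma is_normN v : nu (- v) = nu v.
Proof. by rewrite -scaleN1r is_normZ normrN1 mul1r. Qed.

Lemma is_norm_ge0 v : 0 <= nu v.
Proof. by have := is_normD v (- v); rewrite subrr is_norm0 is_normN; lra. Qed.

Lemma is_norm_eq0 v : nu v = 0 -> v = 0.
Proof.
move=> v0; case: nuP => _ _ [k kP]; apply: l1_eq0; apply/le_anti.
by rewrite l1_ge0 andbT (le_trans (kP _)) // v0 mulr0.
Qed.

Lemma is_norm_sum (I : finType) (P : pred I) (F : I -> 'rV[R]_m) :
  nu (\sum_(i | P i) F i) <= \sum_(i | P i) nu (F i).
Proof.
elim/big_ind2: _ => [|x1 x2 y1 y2 h1 h2|//]; first by rewrite is_norm0.
by apply: le_trans (is_normD _ _) _; apply: lerD.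
Qed.

Lemma det_unit_ball_bounded : exists B, forall Y : 'M[R]_m,
  (forall i, nu (row i Y) <= 1) -> `|\det Y| <= B.
Proof.
case: nuP => _ _ [k kP]; exists (\sum_(s : 'S_m) \prod_(i < m) `|k|) => Y Y1.
apply: le_trans (ler_norm_sum _ _ _) _; apply: ler_sum => s _.
rewrite normrM normrX normrN1 expr1n mul1r normr_prod.
apply: ler_prod => i _; rewrite normr_ge0 /=.
have := l1_entry (row i Y) 0 (s i); rewrite mxE => /le_trans; apply.
apply: le_trans (kP _) _; apply: le_trans (ler_norm _) _.
rewrite normrM ler_piMr // ger0_norm ?is_norm_ge0 //.
Qed.

(** Approaching the supremum up to a factor 2 is enough for what follows, and
    avoids a compactness argument. *)
Lemma almost_largest_volume : exists (V : R) (Y : 'M[R]_m), [/\ 0 < V,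
  forall Z : 'M[R]_m, (forall i, nu (row i Z) <= 1) -> `|\det Z| <= V,
  forall i, nu (row i Y) <= 1 & V / 2 <= `|\det Y|].
Proof.
have [B BP] := det_unit_ball_bounded.
pose E : set R := fun x => exists2 Y : 'M[R]_m,
  forall i, nu (row i Y) <= 1 & `|\det Y| = x.
have EB : has_ubound E by exists B => _ [Y YP <-]; apply: BP.
pose t := (1 + \sum_i nu (row i (1%:M : 'M[R]_m)))^-1.
have t0 : 0 < t.
  by rewrite invr_gt0 ltr_wpDr // sumr_ge0 // => i _; apply: is_norm_ge0.
have Et : E (t ^+ m).
  exists (t%:M); last by rewrite det_scalar ger0_norm // exprn_ge0 // ltW.
  move=> i /=; rewrite -[t]mulr1 -scale_scalar_mx linearZ /= is_normZ gtr0_norm //.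
  rewrite /t mulrC ler_pdivrMr ?mul1r; last by rewrite -invr_gt0.
  rewrite (bigD1 i) //= addrCA lerDl addr_ge0 // sumr_ge0 // => j _.
  exact: is_norm_ge0.
have V0 : 0 < sup E.
  by apply: lt_le_trans (ub_le_sup EB Et); apply: exprn_gt0.
have [|_ [Y YP <-] dY] := @sup_adherent _ E (sup E / 2) (divr_gt0 V0 (ltr0Sn R 1)).
  by split => //; exists (t ^+ m).
exists (sup E), Y; split => //.
- by move=> Z ZP; apply: ub_le_sup => //; exists Z.
- by apply/ltW; move: dY; rewrite {1}[sup E](splitr) addrK.
Qed.

(** Cramer's rule, read along the rows. *)
Lemma det_replace_row (Y : 'M[R]_m) (c : 'rV[R]_m) i0 :
  \det (\matrix_i (if i == i0 then c *m Y else row i Y)) = c 0 i0 * \det Y.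
Proof.
set Y' := (\matrix_i _); rewrite (expand_det_row _ i0).
have -> : \sum_j Y' i0 j * cofactor Y' i0 j = (c *m Y *m \adj Y) 0 i0.
  rewrite [RHS]mxE; apply: eq_bigr => j _.
  have -> : Y' i0 j = (c *m Y) 0 j.
    by rewrite /Y' mxE eqxx.
  congr (_ * _); rewrite mxE /cofactor; congr (_ * \det _).
  apply/matrixP => a b; rewrite !mxE ifN ?mxE //.
  by rewrite eq_sym neq_lift.
by rewrite -mulmxA mul_mx_adj mul_mx_scalar mxE mulrC.
Qed.

(** A basis is kept, starting from small vectors.  If a vector has a coordinate
    larger than [Kp] in it, then it replaces a basis vector, which multiplies the
    volume by more than [Kp]; volumes of bases in the unit ball being bounded,
    this cannot happen [N] times.  When it does not happen, the basis vectors
    that are still small only contribute an error. *)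
Lemma controlled_combination (Kp zeta : R) (N : nat) (u : nat -> 'rV[R]_m) :
  0 < Kp -> 0 < zeta -> zeta <= 1 ->
  2 < Kp ^+ N * zeta ^+ m ->
  (forall l, (l < N)%N -> nu (u l) <= 1) ->
  exists j (P : pred 'I_m) (c : 'I_m -> R) (l : 'I_m -> nat),
    [/\ (j < N)%N, forall i, `|c i| <= Kp, forall i, P i -> (l i < j)%N &
      nu (u j - \sum_(i | P i) c i *: u (l i)) <= m%:R * (Kp * zeta)].
Proof.
move=> Kp0 z0 z1 big uP; apply: contrapT => H.
have [V [Y0 [V0 Vmax Y01 VY0]]] := almost_largest_volume.
have : forall j, (j <= N)%N -> exists Y : 'M[R]_m,
    Kp ^+ j * zeta ^+ m * (V / 2) <= `|\det Y| /\
    forall i, (exists2 l, (l < j)%N & row i Y = u l) \/ nu (row i Y) <= zeta.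
  elim=> [_|j IH jN].
    exists (zeta *: Y0); split=> [|i].
      have zm : 0 <= zeta ^+ m by rewrite exprn_ge0 // ltW.
      by rewrite expr0 mul1r detZ normrM ger0_norm //; apply: ler_wpM2l.
    by right; rewrite linearZ /= is_normZ gtr0_norm // ler_piMr // ltW.
  have [Y [dY YP]] := IH (ltnW jN).
  have uY : Y \in unitmx.
    rewrite unitmxE unitfE -normr_gt0 (lt_le_trans _ dY) //.
    by rewrite !mulr_gt0 ?exprn_gt0.
  pose c := u j *m invmx Y.
  have cE : c *m Y = u j by rewrite /c mulmxKV.
  case: (pselect (forall i, `|c 0 i| <= Kp)) => [cK|/existsNP[i0 /negP]].
    exfalso; apply: H.
    pose Q i := exists2 l, (l < j)%N & row i Y = u l.
    exists j, (fun i => `[< Q i >]), (fun i => c 0 i).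
    exists (fun i => if pselect (Q i) is left e then projT1 (cid2 e) else 0%N).
    split => //.
      move=> i /asboolP Qi; case: pselect => // e; by case: cid2.
    have -> : u j = \sum_i c 0 i *: row i Y.
      by rewrite -cE; apply/rowP => k; rewrite mxE summxE; apply: eq_bigr => i _; rewrite !mxE.
    rewrite (bigID (fun i => `[< Q i >])) /= addrAC -sumrB big1 ?add0r; last first.
      move=> i /asboolP Qi; case: pselect => // e; case: cid2 => l /= _ ->.
      by rewrite subrr.
    apply: le_trans (is_norm_sum _ _) _.
    rewrite mulr_natl -[m in X in _ <= X](card_ord m) -sumr_const.
    rewrite [leRHS](bigID (fun i => ~~ `[< Q i >])) /= -[leLHS]addr0; apply: lerD.
      apply: ler_sum => i /asboolPn nQ; rewrite is_normZ.
      by apply: ler_pM => //; [apply: is_norm_ge0|case: (YP i)].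
    by apply: sumr_ge0 => i _; rewrite mulr_ge0 // ltW.
  rewrite -ltNge => cK.
  exists (\matrix_i (if i == i0 then c *m Y else row i Y)); split.
    rewrite det_replace_row normrM exprS -!mulrA; apply: ler_pM.
    - exact: ltW.
    - by rewrite ltW // !mulr_gt0 ?exprn_gt0.
    - exact: ltW.
    - by move: dY; rewrite -!mulrA.
  move=> i; rewrite rowK; case: eqP => [_|_].
    by left; exists j; rewrite // cE.
  case: (YP i) => [[l lj ->]|small]; last by right.
  by left; exists l; rewrite // ltnS ltnW.
move=> /(_ N (leqnn N)) [Y [dY YP]].
have : `|\det Y| <= V.
  apply: Vmax => i; case: (YP i) => [[l lN ->]|/le_trans]; last exact.
  exact: uP.
apply/negP; rewrite -ltNge (lt_le_trans _ dY) //.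
by rewrite mulrA ltr_pdivlMr // mulrC ltr_pM2r.
Qed.
End Norms.

(** * Almost fixed vectors of combinations of words *)

Definition word_in (T : eqType) (S : set T) (w : seq T) := forall s, s \in w -> S s.

Lemma word_in_cat (T : eqType) (S : set T) (v w : seq T) :
  word_in S v -> word_in S w -> word_in S (v ++ w).
Proof. by move=> vS wS s; rewrite mem_cat => /orP[/vS|/wS]. Qed.

Lemma word_in_take (T : eqType) (S : set T) k (w : seq T) :
  word_in S w -> word_in S (take k w).
Proof. by move=> wS s /mem_take/wS. Qed.

Lemma word_in_drop (T : eqType) (S : set T) k (w : seq T) :
  word_in S w -> word_in S (drop k w).
Proof. by move=> wS s /mem_drop/wS. Qed.

Lemma index_gap N l j : (l < j)%N -> (j < N)%N -> (0 < (N - l) - (N - j) <= N)%N.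
Proof. lia. Qed.

Section BochiNormed.
Variables (R : realType) (n : nat).
Local Notation m := n.+1.
Variable nu : 'rV[R]_m -> R.
Hypothesis nuP : is_norm nu.
Variable S : set 'M[R]_m.
Hypothesis S1 : forall s v, S s -> nu (v *m s) <= nu v.

Lemma norm_word w v : word_in S w -> nu (v *m \prod_(s <- w) s) <= nu v.
Proof.
elim: w v => [|s w IH] v wS; first by rewrite big_nil mulmx1.
have wS' : word_in S w by move=> t tw; apply: wS; rewrite inE tw orbT.
rewrite big_cons -mulmxE mulmxA; apply: le_trans (IH _ wS') _.
by apply: S1; apply: wS; rewrite mem_head.
Qed.

(** Traces of powers of a combination of words expand into traces of words. *)
Lemma trace_combination (X : 'M[R]_m) (P : pred 'I_m) (c : 'I_m -> R)
    (W : 'I_m -> seq 'M[R]_m) (Kp T q : R) (N D : nat) :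
  X = \sum_(i | P i) c i *: \prod_(s <- W i) s ->
  0 <= q <= 1 -> 0 <= T ->
  (forall i, `|c i| <= Kp) ->
  (forall i, P i -> word_in S (W i) /\ (0 < size (W i) <= N)%N) ->
  (forall w, word_in S w -> (0 < size w <= D)%N ->
     `|\tr (\prod_(s <- w) s)| <= T * q ^+ size w) ->
  forall k, (0 < k)%N -> (k * N <= D)%N ->
    `|\tr (X ^+ k)| <= T * (m%:R * Kp * q) ^+ k.
Proof.
move=> XE /andP[q0 q1] T0 cK WP trP.
have Kp0 : 0 <= Kp by apply: le_trans (cK ord0).
suff gen k : forall w, word_in S w -> (0 < k + size w)%N -> (size w + k * N <= D)%N ->
    `|\tr ((\prod_(s <- w) s) * X ^+ k)| <= T * q ^+ (k + size w) * (m%:R * Kp) ^+ k.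
  move=> k k0 kN; have := gen k [::]; rewrite big_nil mul1r addn0 add0n.
  by rewrite -mulrA -exprMn mulrC [q * _]mulrC mulrC; apply.
elim: k => [|k IH] w wS wpos wD.
  rewrite !expr0 !mulr1 add0n; apply: trP => //.
  by rewrite (leq_trans _ wD) ?leq_addr // andbT.
rewrite exprS mulrA {1}XE mulr_sumr mulr_suml raddf_sum /=.
apply: le_trans (ler_norm_sum _ _ _) _.
have term i : P i -> `|\tr (\prod_(s <- w) s * (c i *: \prod_(s <- W i) s) * X ^+ k)|
    <= Kp * (T * q ^+ (k.+1 + size w) * (m%:R * Kp) ^+ k).
  move=> Pi; have [WS /andP[W0 WN]] := WP i Pi.
  rewrite -scalerAr -scalerAl linearZ /= normrM -big_cat /=.
  apply: ler_pM => //.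
  apply: le_trans (IH _ _ _ _) _.
  - exact: word_in_cat.
  - by rewrite size_cat addnA ltn_addl.
  - by rewrite size_cat; apply: leq_trans wD; rewrite mulSn -addnA leq_add2l leq_add2r.
  apply: ler_wpM2r; first by rewrite exprn_ge0 // mulr_ge0.
  apply: ler_wpM2l => //; apply: ler_wiXn2l => //.
  by rewrite size_cat addnA addSn -addn1 leq_add2l.
apply: le_trans (ler_sum _ term) _.
rewrite sumr_const [leRHS]mulrC exprS -!mulrA -[leLHS]mulr_natl.
set Z := Kp * _; have Z0 : 0 <= Z.
  by rewrite /Z !mulr_ge0 // exprn_ge0 // mulr_ge0.
have -> : m%:R * (Kp * ((m%:R * Kp) ^+ k * (T * q ^+ (k.+1 + size w)))) = m%:R * Z.
  by rewrite /Z; ring.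
by apply: ler_wpM2r; rewrite // ler_nat -[leqRHS](card_ord m) max_card.
Qed.

(** The error of one application of [X] grows at most by the factor [K] at each
    further application. *)
Lemma almost_fixed_power (X : 'M[R]_m) (p : 'rV[R]_m) (K eta : R) k : 2 <= K ->
  (forall v, nu (v *m X) <= K * nu v) -> nu (p *m X - p) <= eta ->
  nu (p *m X ^+ k.+1 - p) <= eta * (2 * K ^+ k - 1).
Proof.
move=> K2 XK pX; have eta0 : 0 <= eta by apply: le_trans pX; apply: is_norm_ge0.
elim: k => [|k IH]; first by rewrite expr1 expr0; lra.
have -> : p *m X ^+ k.+2 - p = (p *m X ^+ k.+1 - p) *m X + (p *m X - p).
  by rewrite mulmxBl -mulmxA -[X ^+ k.+1 *m X]exprSr; rewrite addrA subrK.
apply: le_trans (is_normD nuP _ _) _.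
have := XK (p *m X ^+ k.+1 - p).
have := ler_wpM2l (le_trans (ler0n _ 2) K2) IH.
rewrite [K ^+ k.+1]exprS; nra.
Qed.

(** All powers of [X] up to the dimension almost fix [p].  On the other hand the
    characteristic polynomial of [X] is close to that of a nilpotent matrix, so
    that the Cayley-Hamilton theorem makes [p *m X ^+ m] small. *)
Lemma almost_fixed_contradiction (X : 'M[R]_m) (p : 'rV[R]_m) (K q : R) :
  2 <= K -> 0 <= q -> m%:R ^+ 2 * q <= 1 / 16 ->
  (forall v, nu (v *m X) <= K * nu v) ->
  nu (p *m X - p) * (8 * K ^+ n) <= 1 ->
  3 / 4 <= nu p <= 1 ->
  (forall k, (0 < k <= m)%N -> `|\tr (X ^+ k)| <= m%:R * q ^+ k) ->
  False.
Proof.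
move=> K2 q0 qm XK pX /andP[p34 p1] trX.
have K1 : 1 <= K by lra.
have fixed k : (k <= m)%N -> nu (p *m X ^+ k - p) <= 1 / 4.
  case: k => [|k] lek; first by rewrite expr0 mulmx1 subrr is_norm0 //; lra.
  apply: le_trans (almost_fixed_power k K2 XK (lexx _)) _.
  have : K ^+ k <= K ^+ n by apply: ler_weXn2l.
  have := is_norm_ge0 nuP (p *m X - p); nra.
have [e [e0 eP sum0]] := small_traces_annihilator q0 trX.
have {}sum0 : p *m X ^+ m = - \sum_(k < m) e k.+1 *: (p *m X ^+ (n - k)).
  move/(congr1 (mulmx p)): sum0; rewrite big_ord_recl mulmx0 e0 scale1r subn0.
  rewrite mulmxDr => /eqP; rewrite addr_eq0 => /eqP ->; congr (- _).
  by rewrite mulmx_sumr; apply: eq_bigr => i _; rewrite -scalemxAr.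
have mq0 : 0 <= m%:R * q by apply: mulr_ge0.
have mge1 : 1 <= m%:R :> R by rewrite ler1n.
have mq1 : m%:R * q <= 1 by nra.
have small : nu (p *m X ^+ m) <= 5 / 64.
  rewrite sum0 is_normN //; apply: le_trans (is_norm_sum nuP _ _) _.
  have -> : 5 / 64 = \sum_(k < m) (5 / 64 / m%:R) :> R.
    by rewrite sumr_const card_ord -[RHS]mulr_natr divfK // pnatr_eq0.
  apply: ler_sum => k _; rewrite is_normZ //.
  have ek : `|e k.+1| <= m%:R * q.
    apply: le_trans (eP _ _) _; first exact: ltn_ord.
    by rewrite exprS ler_piMr // exprn_ile1.
  have nuk : nu (p *m X ^+ (n - k)) <= 5 / 4.
    have -> : p *m X ^+ (n - k) = (p *m X ^+ (n - k) - p) + p by rewrite subrK.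
    apply: le_trans (is_normD nuP _ _) _.
    by have := fixed (n - k)%N (leq_trans (leq_subr _ _) (leqnSn _)); lra.
  apply: le_trans (ler_pM _ _ ek nuk) _ => //; first exact: is_norm_ge0.
  by rewrite ler_pdivlMr ?ltr0n //; lra.
have := fixed m (leqnn _).
set a := p *m X ^+ m in small *.
have : nu p <= nu a + nu (a - p).
  rewrite -[X in _ <= _ + X](is_normN nuP) opprB.
  by apply: le_trans (is_normD nuP _ _); rewrite addrC subrK.
lra.
Qed.

(** Suppose that a word does not shrink [v] much.  The images of [v] by the
    prefixes then stay in the unit ball and away from 0.  They are read backwards,
    so that the vectors that come before a given one are its images by words, and
    a controlled combination of them is its image by a combination of words. *)
Lemma bochi_normed : (0 < n)%N ->
  (forall w, word_in S w -> (0 < size w <= 2 * m ^ 3)%N ->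
     `|\tr (\prod_(s <- w) s)| <= m%:R * (256 * m%:R ^+ 5)^-1 ^+ size w) ->
  forall w v, word_in S w -> size w = (2 * m ^ 2)%N ->
  nu v = 1 -> nu (v *m \prod_(s <- w) s) < 3 / 4.
Proof.
move=> n0 trS w v wS szw v1; rewrite ltNge; apply/negP => big.
pose N := (2 * m ^ 2)%N.
pose t i := v *m \prod_(s <- take i w) s.
have tD i j : (i <= j)%N -> t j = t i *m \prod_(s <- drop i (take j w)) s.
  move=> ij; rewrite /t -mulmxA mulmxE -{1}(cat_take_drop i (take j w)) big_cat /=.
  by rewrite take_takel.
have tle i : nu (t i) <= 1.
  by rewrite -v1; apply: norm_word; apply: word_in_take.
have tge i : (i <= N)%N -> 3 / 4 <= nu (t i).
  move=> iN; apply: le_trans big _.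
  have -> : v *m \prod_(s <- w) s = t N by rewrite /t take_oversize // szw.
  rewrite (tD _ _ iN); apply: norm_word; apply: word_in_drop; exact: word_in_take.
(* [zeta] makes the error of the combination negligible in front of the
   amplification [K ^+ n] by the powers of the matrix; the lengths and [Kp] are
   such that the volume [Kp ^+ N * zeta ^+ m] is [8 ^+ (n * m)] *)
pose Kp : R := 8 * m%:R.
pose K : R := 8 * m%:R ^+ 2.
have m2 : 2 <= m%:R :> R by rewrite ler_nat.
have KpK : m%:R * Kp = K by rewrite /Kp /K; ring.
have K0 : 0 < K by rewrite /K mulr_gt0 // exprn_gt0 // ltr0n.
pose zeta : R := (8 * K ^+ m)^-1.
have z0 : 0 < zeta by rewrite invr_gt0 mulr_gt0 // exprn_gt0.
have K1 : 1 <= K by rewrite /K; nra.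
have z1 : zeta <= 1.
  rewrite invf_le1 ?mulr_gt0 ?exprn_gt0 //.
  by have := exprn_ege1 m K1; lra.
have volume : 2 < Kp ^+ N * zeta ^+ m.
  have -> : Kp ^+ N * zeta ^+ m = (8 ^+ n) ^+ m.
    have -> : N = (2 * m * m)%N by rewrite /N -mulnA mulnn.
    rewrite exprM -exprMn exprM; congr (_ ^+ _).
    have -> : Kp ^+ 2 = 8 * K by rewrite /Kp /K; ring.
    rewrite exprMn /zeta [8 ^+ m]exprS.
    have y0 : K ^+ m != 0 by rewrite lt0r_neq0 // exprn_gt0.
    by move: (K ^+ m) y0 (8 ^+ n) => y y0 z; field.
  have e8 : 8 <= 8 ^+ n :> R by rewrite -[leLHS]expr1 ler_weXn2l // ler1n.
  apply: (@lt_le_trans _ _ (8 ^+ n)); first by lra.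
  by rewrite -[leLHS]expr1 ler_weXn2l //; lra.
have Kp0 : 0 < Kp by rewrite /Kp mulr_gt0 // ltr0n.
have [j [P [c [l [jN cK lP close]]]]] := @controlled_combination _ _ nu nuP Kp zeta N
  (fun l => t (N - l)%N) Kp0 z0 z1 volume (fun _ _ => tle _).
pose W i := drop (N - j) (take (N - l i) w).
pose X := \sum_(i | P i) c i *: \prod_(s <- W i) s.
pose p := t (N - j)%N.
have WS i : word_in S (W i) by apply: word_in_drop; apply: word_in_take.
have szW i : P i -> (0 < size (W i) <= N)%N.
  by move=> /lP lij; rewrite size_drop size_takel ?szw ?leq_subr // index_gap.
have pX : nu (p *m X - p) <= m%:R * (Kp * zeta).
  rewrite -(is_normN nuP) opprB /X mulmx_sumr; move: close; congr (nu (_ - _) <= _).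
  apply: eq_bigr => i /lP lij; rewrite -scalemxAr; congr (_ *: _).
  by rewrite /p -tD // leq_sub2l // ltnW.
apply: (@almost_fixed_contradiction X p K (K * (256 * m%:R ^+ 5)^-1)).
- by rewrite /K; nra.
- by rewrite mulr_ge0 ?(ltW K0) // invr_ge0 mulr_ge0 ?exprn_ge0.
- have m0 : m%:R != 0 :> R by rewrite pnatr_eq0.
  have -> : m%:R ^+ 2 * (K * (256 * m%:R ^+ 5)^-1) = (32 * m%:R)^-1.
    by rewrite /K; field.
  by rewrite -[leRHS]invf_div divr1 lef_pV2 ?posrE ?mulr_gt0 ?ltr0n //; lra.
- move=> u; rewrite /X mulmx_sumr; apply: le_trans (is_norm_sum nuP _ _) _.
  apply: (@le_trans _ _ (\sum_(i | P i) Kp * nu u)).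
    apply: ler_sum => i Pi; rewrite -scalemxAr is_normZ //.
    by apply: ler_pM => //; [apply: is_norm_ge0|apply: norm_word].
  rewrite sumr_const -[leLHS]mulr_natl -KpK -mulrA; apply: ler_wpM2r.
    by rewrite mulr_ge0 ?is_norm_ge0 // ltW.
  by rewrite ler_nat -[leqRHS](card_ord m) max_card.
- apply: le_trans (ler_wpM2r _ pX) _; first by rewrite mulr_ge0 // exprn_ge0 // ltW.
  rewrite mulrA KpK /zeta exprS.
  have y0 : K ^+ n != 0 by rewrite lt0r_neq0 // exprn_gt0.
  have K0' := lt0r_neq0 K0.
  have -> // : K * (8 * (K * K ^+ n))^-1 * (8 * K ^+ n) = 1.
  by move: (K ^+ n) y0 => y y0; field; rewrite y0.
- by rewrite tle tge // leq_subr.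
- move=> k /andP[k0 km].
  have C1 : 1 <= 256 * m%:R ^+ 5 :> R.
    by have : 1 <= m%:R ^+ 5 :> R; [rewrite exprn_ege1 // ler1n|lra].
  have Cpos : 0 < 256 * m%:R ^+ 5 :> R by apply: lt_le_trans C1.
  have q01 : (0 <= (256 * m%:R ^+ 5)^-1 :> R) && ((256 * m%:R ^+ 5)^-1 <= 1 :> R).
    by rewrite invr_ge0 invf_le1 // C1 ltW.
  have := @trace_combination X P c W Kp m%:R (256 * m%:R ^+ 5)^-1 N (2 * m ^ 3) erefl
    q01 (ler0n _ _) cK _ trS k k0.
  rewrite KpK; apply.
  + by move=> i Pi; split; [apply: WS|apply: szW].
  + by rewrite /N mulnCA leq_mul2l /= [(m ^ 3)%N]expnS leq_mul2r km orbT.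
Qed.
End BochiNormed.

(** * The growth of products is controlled by traces of short products *)

Section Bochi.
Variables (R : realType) (n : nat).
Local Notation m := n.+1.
Implicit Types S : set 'M[R]_m.

Definition words_grow S (mu : R) := exists K, forall w, word_in S w ->
  l1 (\prod_(s <- w) s) <= K * mu ^+ size w.

Lemma words_growW S mu mu' : 0 <= mu -> mu <= mu' -> words_grow S mu -> words_grow S mu'.
Proof.
move=> mu0 le_mu [K KP]; exists K => w wS; apply: le_trans (KP w wS) _.
have K0 : 0 <= K.
  have := KP [::]; rewrite big_nil expr0 mulr1 => K0.
  by apply: le_trans (K0 _); rewrite ?l1_ge0.
by apply: ler_wpM2l => //; rewrite lerXn2r // nnegrE (le_trans mu0).
Qed.

Lemma words_grow_bounded S b : (forall s, S s -> l1 s <= b) -> words_grow S (`|b| + 1).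
Proof.
move=> Sb; exists (l1 (1 : 'M[R]_m)) => w; elim: w => [|s w IH] wS.
  by rewrite big_nil expr0 mulr1.
have wS' : word_in S w by move=> t tw; apply: wS; rewrite inE tw orbT.
rewrite big_cons /= exprS mulrCA; apply: le_trans (l1M _ _) _.
apply: ler_pM; rewrite ?l1_ge0 ?IH //.
have : l1 s <= b by apply: Sb; apply: wS; rewrite mem_head.
by have := ler_norm b; lra.
Qed.

(** The norm for which no element of [S] expands by more than [mu], finite as
    soon as the growth rate of words is at most [mu]. *)
Definition adapted_norm S (mu : R) (v : 'rV[R]_m) : R :=
  sup [set x | exists2 w, word_in S w & x = l1 (v *m \prod_(s <- w) s) / mu ^+ size w].

Section AdaptedNorm.
Variables (S : set 'M[R]_m) (mu : R).
Hypotheses (mu0 : 0 < mu) (growS : words_grow S mu).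
Local Notation nu := (adapted_norm S mu).

Lemma adapted_norm_bound : exists K, forall (v : 'rV[R]_m) w, word_in S w ->
  l1 (v *m \prod_(s <- w) s) / mu ^+ size w <= K * l1 v.
Proof.
case: growS => K KP; exists K => v w wS.
rewrite ler_pdivrMr ?exprn_gt0 //; apply: le_trans (l1M _ _) _.
by rewrite mulrAC [leRHS]mulrC ler_wpM2l ?l1_ge0 // KP.
Qed.

Lemma adapted_norm_ge v w : word_in S w ->
  l1 (v *m \prod_(s <- w) s) <= nu v * mu ^+ size w.
Proof.
move=> wS; rewrite -ler_pdivrMr ?exprn_gt0 //; apply: ub_le_sup; last by exists w.
by have [K KP] := adapted_norm_bound; exists (K * l1 v) => _ [u uS ->]; apply: KP.
Qed.

Lemma adapted_norm_le v x :
  (forall w, word_in S w -> l1 (v *m \prod_(s <- w) s) <= x * mu ^+ size w) ->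
  nu v <= x.
Proof.
move=> xP; apply: ge_sup.
  by eexists; exists [::] => //; move=> s; rewrite in_nil.
by move=> _ [w wS ->]; rewrite ler_pdivrMr ?exprn_gt0 // xP.
Qed.

Lemma adapted_norm_ge_l1 v : l1 v <= nu v.
Proof.
by have := @adapted_norm_ge v [::]; rewrite big_nil mulmx1 expr0 mulr1; apply.
Qed.

Lemma adapted_normP : is_norm nu.
Proof.
have half a v : nu (a *: v) <= `|a| * nu v.
  apply: adapted_norm_le => w wS.
  by rewrite -scalemxAl l1Z -mulrA ler_wpM2l // adapted_norm_ge.
split=> [u v|a v|]; last by exists 1 => v; rewrite mul1r adapted_norm_ge_l1.
  apply: adapted_norm_le => w wS; rewrite mulmxDl mulrDl.
  by apply: le_trans (l1D _ _) _; apply: lerD; apply: adapted_norm_ge.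
apply/le_anti; rewrite half /=; have [->|a0] := eqVneq a 0.
  by rewrite normr0 mul0r (le_trans _ (adapted_norm_ge_l1 _)) ?l1_ge0.
have := half a^-1 (a *: v); rewrite scalerA mulVf // scale1r normfV.
by rewrite ler_pdivlMl ?normr_gt0.
Qed.

Lemma adapted_norm_contract s v : S s -> nu (v *m s) <= mu * nu v.
Proof.
move=> Ss; apply: adapted_norm_le => w wS.
have := @adapted_norm_ge v (s :: w); rewrite big_cons /= exprS -mulmxE mulmxA.
rewrite mulrA [nu v * mu]mulrC; apply=> t; rewrite inE => /predU1P[->//|]; exact: wS.
Qed.

(** A word is cut into subwords of length [N], each of which gains a factor
    [q ^+ N]. *)
Lemma words_grow_improve (q : R) (N : nat) : 0 < q -> q <= 1 -> (0 < N)%N ->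
  (forall w v, word_in S w -> size w = N ->
     nu (v *m \prod_(s <- w) s) <= (q * mu) ^+ N * nu v) ->
  words_grow S (q * mu).
Proof.
move=> q0 q1 N0 short.
have crude w v : word_in S w -> nu (v *m \prod_(s <- w) s) <= mu ^+ size w * nu v.
  elim: w v => [|s w IH] v wS; first by rewrite big_nil mulmx1 expr0 mul1r.
  rewrite big_cons -mulmxE mulmxA /= exprSr -mulrA.
  apply: le_trans (IH _ _) _; first by move=> t tw; apply: wS; rewrite inE tw orbT.
  apply: ler_wpM2l; first by rewrite exprn_ge0 // ltW.
  by apply: adapted_norm_contract; apply: wS; rewrite mem_head.
have nuP := adapted_normP.
have main k : forall w v, size w = k -> word_in S w ->
    nu (v *m \prod_(s <- w) s) <= q ^- N * (q * mu) ^+ k * nu v.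
  elim/ltn_ind: k => k IH w v szw wS.
  have [kN|Nk] := ltnP k N.
    apply: le_trans (crude _ _ wS) _; apply: ler_wpM2r; first exact: is_norm_ge0.
    have qq : 1 <= q ^- N * q ^+ k.
      rewrite mulrC ler_pdivlMr ?exprn_gt0 // mul1r.
      by apply: ler_wiXn2l => //; [exact: ltW|exact: ltnW].
    by rewrite szw exprMn mulrA ler_peMl // exprn_ge0 // ltW.
  rewrite -(cat_take_drop N w) big_cat /= -mulmxE mulmxA.
  apply: le_trans (IH (k - N)%N _ _ _ _ _) _.
  - lia.
  - by rewrite size_drop szw.
  - exact: word_in_drop.
  have := short (take N w) v (word_in_take wS).
  rewrite size_takel ?szw // => /(_ erefl) step.
  rewrite -!mulrA; apply: ler_wpM2l; first by rewrite invr_ge0 exprn_ge0 // ltW.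
  rewrite -[in leRHS](subnK Nk) exprD -mulrA; apply: ler_wpM2l => //.
  by rewrite exprn_ge0 // mulr_ge0 // ltW.
exists (\sum_i q ^- N * nu (row i 1%:M)) => w wS.
have -> : l1 (\prod_(s <- w) s) = \sum_i l1 (row i (1%:M : 'M[R]_m) *m \prod_(s <- w) s).
  rewrite /l1; apply: eq_bigr => i _; rewrite big_ord1 -row_mul mul1mx.
  by apply: eq_bigr => j _; rewrite !mxE.
rewrite mulr_suml; apply: ler_sum => i _.
apply: le_trans (adapted_norm_ge_l1 _) _; apply: le_trans (main _ _ _ erefl wS) _.
by rewrite mulrAC.
Qed.
End AdaptedNorm.

Lemma prod_scale (a : R) (w : seq 'M[R]_m) :
  \prod_(s <- [seq a *: s | s <- w]) s = a ^+ size w *: \prod_(s <- w) s.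
Proof.
elim: w => [|s w IH] /=; first by rewrite !big_nil expr0 scale1r.
by rewrite !big_cons IH exprS -scalerAl -scalerAr scalerA.
Qed.

(** An inequality of Bochi, with constants polynomial in the dimension.  If the
    optimal growth rate of words were larger, then for a norm adapted to it some
    long word would hardly shrink some vector, against [bochi_normed]. *)
Theorem words_grow_of_traces S (b M : R) : (0 < n)%N ->
  (forall s, S s -> l1 s <= b) -> 0 < M ->
  (forall w, word_in S w -> (0 < size w <= 2 * m ^ 3)%N ->
     `|\tr (\prod_(s <- w) s)| <= m%:R * M ^+ size w) ->
  words_grow S (256 * m%:R ^+ 5 * M).
Proof.
move=> n0 Sb M0 trS; apply: contrapT => nogrow.
set C : R := 256 * m%:R ^+ 5.
have C0 : 0 < C by rewrite mulr_gt0 // exprn_gt0 // ltr0n.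
have CM0 : 0 < C * M by apply: mulr_gt0.
pose E : set R := fun mu => 0 < mu /\ words_grow S mu.
have Einf : has_inf E.
  split; last by exists 0 => x [/ltW].
  by exists (`|b| + 1); split; [rewrite ltr_wpDl|exact: words_grow_bounded Sb].
have lbE mu : E mu -> C * M <= mu.
  case=> mu0 gmu; rewrite leNgt; apply/negP => /ltW lt; apply: nogrow.
  by apply: words_growW gmu; rewrite // ltW.
pose r := inf E.
have rCM : C * M <= r by apply: lb_le_inf Einf.1 _ => x; apply: lbE.
have r0 : 0 < r by apply: lt_le_trans rCM.
pose N := (2 * m ^ 2)%N.
have N0 : (0 < N)%N by rewrite muln_gt0 expn_gt0.
pose q : R := 1 - (4 * N%:R)^-1.
have Nr : 1 <= N%:R :> R by rewrite ler1n.
have iN : 0 < (4 * N%:R)^-1 :> R by rewrite invr_gt0; lra.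
have iN1 : (4 * N%:R)^-1 <= 4^-1 :> R by rewrite lef_pV2 ?posrE //; lra.
have q0 : 0 < q by rewrite /q; lra.
have q1 : q < 1 by rewrite /q; lra.
have qN : 3 / 4 <= q ^+ N.
  have bern k : 1 - k%:R * (4 * N%:R)^-1 <= q ^+ k.
    elim: k => [|k IH]; first by rewrite mul0r expr0 subr0.
    rewrite exprS -natr1; apply: le_trans (ler_wpM2l (ltW q0) IH).
    rewrite /q; move: iN; set x := (4 * N%:R)^-1 => x0.
    have k0 : 0 <= k%:R :> R by [].
    nra.
  apply: le_trans (bern N); rewrite invfM mulrCA mulfV ?lt0r_neq0 //; lra.
(* [mu] is so close to the optimal rate [r] that [q * mu] is not a growth rate:
   some word of length [N] shrinks the adapted norm by less than [q ^+ N] *)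
have [mu [mu0 gmu] mur] : exists2 mu, E mu & mu < r / q.
  have [|x Ex lx] := @inf_adherent _ E (r / q - r) _ Einf.
    by rewrite subr_gt0 ltr_pdivlMr // gtr_pMr.
  by exists x; rewrite // addrC subrK in lx.
have qmu : q * mu < r by rewrite mulrC -ltr_pdivlMr.
have nq : ~ words_grow S (q * mu).
  move=> g; have : r <= q * mu by apply: (ge_inf Einf.2); split => //; apply: mulr_gt0.
  by rewrite leNgt qmu.
apply: nq; apply: (@words_grow_improve _ _ mu0 gmu _ N) => //; first exact: ltW.
move=> w v wS szw; set nu := adapted_norm S mu.
have nuP : is_norm nu := adapted_normP mu0 gmu.
have [v0|v0] := eqVneq (nu v) 0.
  by rewrite (is_norm_eq0 nuP v0) mul0mx is_norm0 // mulr0.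
have vp : 0 < nu v by rewrite lt_def v0 is_norm_ge0.
pose S' : set 'M[R]_m := fun t => exists2 s, S s & t = mu^-1 *: s.
have wS' : word_in S' [seq mu^-1 *: s | s <- w].
  by move=> _ /mapP[s sw ->]; exists s => //; apply: wS.
have lift u : word_in S' u -> exists2 u0, word_in S u0 & u = [seq mu^-1 *: s | s <- u0].
  elim: u => [|t u IH] uS; first by exists [::].
  have [|u0 u0S ->] := IH; first by move=> x xu; apply: uS; rewrite inE xu orbT.
  have [s Ss ->] := uS t (mem_head _ _).
  by exists (s :: u0) => // x; rewrite inE => /predU1P[->//|]; apply: u0S.
have : nu (((nu v)^-1 *: v) *m \prod_(s <- [seq mu^-1 *: s | s <- w]) s) < 3 / 4.
  apply: (@bochi_normed _ _ nu nuP S') => //.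
  - move=> t u [s Ss ->]; rewrite -scalemxAr is_normZ // gtr0_norm ?invr_gt0 //.
    by rewrite ler_pdivrMl //; apply: adapted_norm_contract.
  - move=> _ /lift[u uS ->]; rewrite size_map prod_scale => szu.
    have ge0 : 0 <= mu^-1 ^+ size u by rewrite exprn_ge0 // invr_ge0 ltW.
    rewrite linearZ /= normrM ger0_norm //.
    apply: le_trans (ler_wpM2l ge0 (trS _ uS szu)) _.
    rewrite mulrCA -exprMn; apply: ler_wpM2l => //.
    have CmuM : C * M <= mu.
      by apply: le_trans rCM _; apply: (ge_inf Einf.2); split.
    have le1 : mu^-1 * M <= C^-1.
      by rewrite ler_pdivrMl // ler_pdivlMr // mulrC.
    by rewrite lerXn2r // nnegrE ?invr_ge0 ?mulr_ge0 ?invr_ge0 // ltW.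
  - by rewrite size_map.
  - by rewrite is_normZ // gtr0_norm ?invr_gt0 // mulVf.
rewrite prod_scale szw -scalemxAl -scalemxAr scalerA is_normZ //.
rewrite ger0_norm; last by rewrite mulr_ge0 ?exprn_ge0 ?invr_ge0 // ltW.
rewrite exprVn -invfM mulrC ltr_pdivrMr ?mulr_gt0 ?exprn_gt0 // => /ltW.
move=> /le_trans; apply; rewrite exprMn [nu v * _]mulrC mulrA.
have muN : 0 <= mu ^+ N by rewrite exprn_ge0 // ltW.
exact: (ler_wpM2r (ltW vp) (ler_wpM2r muN qN)).
Qed.
End Bochi.

(** * Euclidean norm and singular values *)

Section Euclid.
Variable R : realType.

Definition dot n (u v : 'cV[R]_n) : R := \sum_i u i 0 * v i 0.
Definition enorm n (v : 'cV[R]_n) : R := Num.sqrt (dot v v).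

Lemma dotE n (u v : 'cV[R]_n) : dot u v = (u^T *m v) 0 0.
Proof. by rewrite mxE; apply: eq_bigr => i _; rewrite mxE. Qed.

Lemma dotC n (u v : 'cV[R]_n) : dot u v = dot v u.
Proof. by apply: eq_bigr => i _; rewrite mulrC. Qed.

Lemma dotDl n (u v w : 'cV[R]_n) : dot (u + v) w = dot u w + dot v w.
Proof. by rewrite /dot -big_split; apply: eq_bigr => i _; rewrite mxE mulrDl. Qed.

Lemma dotDr n (u v w : 'cV[R]_n) : dot w (u + v) = dot w u + dot w v.
Proof. by rewrite dotC dotDl dotC [dot v w]dotC. Qed.

Lemma dotZl n a (u v : 'cV[R]_n) : dot (a *: u) v = a * dot u v.
Proof. by rewrite /dot mulr_sumr; apply: eq_bigr => i _; rewrite mxE mulrA. Qed.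

Lemma dotZr n a (u v : 'cV[R]_n) : dot u (a *: v) = a * dot u v.
Proof. by rewrite dotC dotZl dotC. Qed.

Lemma dotNl n (u v : 'cV[R]_n) : dot (- u) v = - dot u v.
Proof. by rewrite -scaleN1r dotZl mulN1r. Qed.

Lemma dotNr n (u v : 'cV[R]_n) : dot u (- v) = - dot u v.
Proof. by rewrite dotC dotNl dotC. Qed.

Lemma dot_ge0 n (v : 'cV[R]_n) : 0 <= dot v v.
Proof. by apply: sumr_ge0 => i _; rewrite -expr2 sqr_ge0. Qed.

Lemma dot_adj m n (A : 'M[R]_(m, n)) u v : dot (A *m u) v = dot u (A^T *m v).
Proof. by rewrite !dotE trmx_mul mulmxA. Qed.

Lemma enorm_ge0 n (v : 'cV[R]_n) : 0 <= enorm v.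
Proof. exact: sqrtr_ge0. Qed.

Lemma enorm_sqr n (v : 'cV[R]_n) : enorm v ^+ 2 = dot v v.
Proof. by rewrite sqr_sqrtr // dot_ge0. Qed.

Lemma enormZ n a (v : 'cV[R]_n) : enorm (a *: v) = `|a| * enorm v.
Proof. by rewrite /enorm dotZl dotZr mulrA -expr2 sqrtrM ?sqr_ge0 // sqrtr_sqr. Qed.

Lemma enormN n (v : 'cV[R]_n) : enorm (- v) = enorm v.
Proof. by rewrite -scaleN1r enormZ normrN1 mul1r. Qed.

Lemma enorm_eq0 n (v : 'cV[R]_n) : enorm v = 0 -> v = 0.
Proof.
move=> v0; have := enorm_sqr v; rewrite v0 expr0n /= => /esym/eqP.
rewrite psumr_eq0 => [/allP vi|i _]; last by rewrite -expr2 sqr_ge0.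
apply/matrixP => i j; rewrite ord1 mxE; apply/eqP; rewrite -sqrf_eq0 expr2.
by apply: vi; rewrite mem_index_enum.
Qed.

Lemma cauchy_schwarz n (u v : 'cV[R]_n) : `|dot u v| <= enorm u * enorm v.
Proof.
have [v0|v0] := eqVneq (enorm v) 0.
  by rewrite (enorm_eq0 v0) dotC -[X in dot X](scale0r 0) dotZl mul0r normr0 mulr_ge0 ?enorm_ge0.
have vv : 0 < dot v v by rewrite -enorm_sqr exprn_gt0 // lt_def v0 enorm_ge0.
rewrite -[leLHS]sqrtr_sqr -sqrtrM ?dot_ge0 // ler_wsqrtr //.
have := dot_ge0 (dot v v *: u - dot u v *: v).
rewrite !(dotDl, dotDr, dotNl, dotNr, dotZl, dotZr) [dot v u]dotC.
rewrite -subr_ge0 => ge; rewrite -subr_ge0 -(pmulr_rge0 _ vv).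
by move: ge; congr (0 <= _); ring.
Qed.

Lemma enormD n (u v : 'cV[R]_n) : enorm (u + v) <= enorm u + enorm v.
Proof.
rewrite -(@ler_pXn2r _ 2) ?nnegrE ?addr_ge0 ?enorm_ge0 // enorm_sqr.
rewrite !(dotDl, dotDr) sqrrD !enorm_sqr [dot v u]dotC.
by have := cauchy_schwarz u v; have := ler_norm (dot u v); lra.
Qed.
End Euclid.

Section SingularValues.
Variables (R : realType) (n : nat).
Local Notation k := n.+1.
Implicit Types A : 'M[R]_k.

Definition complex_vec (v : 'cV[R]_k) : 'cV[R[i]]_k := map_mx (real_complex R) v.

(** The spectral theorem for [A^T *m A], over the complex numbers; [w] gives
    the coordinates of real vectors in a unitary basis of eigenvectors. *)
Lemma gram_spectral A : exists (d : 'I_k -> R) (w : 'cV[R]_k -> 'I_k -> R[i]),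
  (forall i, 0 <= d i) /\ [/\ perm_eq (spectrum (A^T *m A)) [seq ((d i)%:C)%C | i <- enum 'I_k],
      forall a u i, w (a *: u) i = (a%:C)%C * w u i,
      forall u v, \sum_i (w u i)^* * w v i = ((dot u v)%:C)%C,
      forall u v, \sum_i ((d i)%:C)%C * ((w u i)^* * w v i) =
                  ((dot (A *m u) (A *m v))%:C)%C
    & forall u i, w (A^T *m A *m u) i = ((d i)%:C)%C * w u i].
Proof.
pose H := complex_mx (A^T *m A).
have conj_real p q (B : 'M[R]_(p, q)) :
    map_mx Num.conj (map_mx (real_complex R) B) = map_mx (real_complex R) B.
  by apply/matrixP => i j; rewrite !mxE; apply/CrealP; rewrite complex_real.
have trc p q (B : 'M[R]_(p, q)) :
    (map_mx (real_complex R) B)^T = map_mx (real_complex R) B^T.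
  by apply/matrixP => i j; rewrite !mxE.
have HE0 : H = (complex_mx A)^T *m complex_mx A.
  by rewrite /H /complex_mx map_mxM map_trmx.
have Hsym : H \is symmetricmx.
  apply/is_hermitianmxP; rewrite expr0 scale1r map_mx_id //.
  by rewrite HE0 trmx_mul trmxK.
have Hreal : H \is a mxOver Num.real.
  by apply/mxOverP => i j; rewrite mxE complex_real.
have Hherm := realsym_hermsym Hsym Hreal.
have Dreal := hermitian_spectral_diag_real Hherm.
have /hermitian_normalmx/orthomx_spectralP HE := Hherm.
have Punit := spectral_unit H.
have := spectral_unitarymx H.
set P := spectralmx H in HE Punit *; set D := spectral_diag H in HE Dreal.
move=> Punitary; have invP := invmx_unitary Punitary.
pose d i := complex.Re (D 0 i).
have dE i : ((d i)%:C)%C = D 0 i by rewrite RRe_real // (mxOverP Dreal).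
pose w v i := (P *m complex_vec v) i 0.
have c3 u v : \sum_i (w u i)^* * w v i = ((dot u v)%:C)%C.
  transitivity ((map_mx Num.conj (P *m complex_vec u)^T *m (P *m complex_vec v)) 0 0).
    have mapT (B : 'cV[R[i]]_k) i : map_mx Num.conj B^T 0 i = (B i 0)^*.
      by rewrite !mxE.
    by rewrite [RHS]mxE; apply: eq_bigr => i _; rewrite mapT.
  rewrite trmx_mul map_mxM mulmxA -[X in X *m complex_vec v]mulmxA -invP mulVmx //.
  by rewrite mulmx1 /complex_vec trc conj_real -map_mxM mxE -dotE.
have c5 u i : w (A^T *m A *m u) i = ((d i)%:C)%C * w u i.
  rewrite dE /w /complex_vec map_mxM -/(complex_mx _) -/H HE !mulmxA mulmxV // mul1mx.
  by rewrite -mulmxA mul_diag_mx mxE.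
exists d, w; split; last split => //.
- move=> i; rewrite -lecR dE.
  pose G := complex_mx A *m (map_mx Num.conj P^T).
  have -> : D 0 i = (map_mx Num.conj G^T *m G) i i.
    rewrite /G trmx_mul map_mxM trmxCK /complex_mx trc conj_real -trc -/(complex_mx A).
    rewrite mulmxA -[X in X *m (map_mx _ P^T)]mulmxA -HE0 -invP HE.
    by rewrite !mulmxA mulmxV // mul1mx mulmxK // mxE eqxx.
  by rewrite mxE; apply: sumr_ge0 => j _; rewrite !mxE mulrC mul_conjC_ge0.
- apply: prod_XsubC_eq; rewrite -char_poly_spectrum -/H HE char_poly_invmx_conj //.
  rewrite char_poly_trig ?diag_mx_is_trig // big_map big_enum.
  by apply: eq_bigr => i _; rewrite dE mxE eqxx.
- move=> a u i; rewrite /w.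
  have -> : complex_vec (a *: u) = (a%:C)%C *: complex_vec u.
    by apply/matrixP => ? ?; rewrite !mxE rmorphM.
  by rewrite -scalemxAr mxE.
- move=> u v; transitivity (\sum_i (w u i)^* * w (A^T *m A *m v) i).
    by apply: eq_bigr => i _; rewrite c5 mulrCA.
  by rewrite c3 -mulmxA -dot_adj.
Qed.

Lemma singular_values_perm A (d : 'I_k -> R) :
  perm_eq (spectrum (A^T *m A)) [seq ((d i)%:C)%C | i <- enum 'I_k] ->
  perm_eq (singular_values A) [seq Num.sqrt (d i) | i <- enum 'I_k].
Proof.
move=> peq; rewrite /singular_values perm_sort.
by apply: perm_trans (perm_map _ peq) _; rewrite -map_comp.
Qed.

Lemma prod_singular_values A : \prod_(s <- singular_values A) s = `|\det A|.
Proof.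
have [d [w [d0 [peq _ _ _ _]]]] := gram_spectral A.
rewrite (perm_big _ (singular_values_perm peq)) /= big_map big_enum /=.
have prod0 : 0 <= \prod_i Num.sqrt (d i) by apply: prodr_ge0 => i _; rewrite sqrtr_ge0.
rewrite -[LHS]ger0_norm // -sqrtr_sqr -[RHS]sqrtr_sqr; congr Num.sqrt.
apply: (@complexI R); rewrite -prodrXl.
have -> : \prod_i Num.sqrt (d i) ^+ 2 = \prod_i d i.
  by apply: eq_bigr => i _; rewrite sqr_sqrtr.
have -> : \det A ^+ 2 = \det (A^T *m A) by rewrite det_mulmx det_tr.
have := char_poly_det (complex_mx (A^T *m A)).
rewrite char_poly_spectrum coef0_prod_XsubC (perm_big _ peq) (perm_size peq).
rewrite size_map size_enum_ord => /(can_inj (signrMK _)).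
rewrite big_map big_enum /= det_map_mx rmorph_prod => <- //.
Qed.
End SingularValues.

Section TopSingular.
Variables (R : realType) (n : nat).
Local Notation k := n.+2.
Implicit Types A : 'M[R]_k.

Lemma singular_values_split A (f : 'I_k -> R) :
  perm_eq (singular_values A) [seq f i | i <- enum 'I_k] ->
  exists (i0 : 'I_k) (l : seq R),
   [/\ singular_values A = [:: singular_value 1 A, singular_value 2 A & l],
       f i0 = singular_value 1 A, forall i, i != i0 -> f i <= singular_value 2 A,
       singular_value 2 A <= singular_value 1 A
     & forall x, x \in l -> x <= singular_value 1 A].
Proof.
move=> peq; have := perm_size peq; rewrite size_map size_enum_ord.
have : sorted >=%R (singular_values A).
  by apply: sort_sorted => x y; rewrite le_total.
rewrite /singular_value; case: (singular_values A) peq => [|x [|y l]] //= peq /andP[yx pl] _.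
have trge : transitive (>=%R : rel R) by move=> a b c; apply: (fun h1 h2 => le_trans h2 h1).
have yl z : z \in l -> z <= y.
  by move/allP: (order_path_min trge pl) => /[apply].
have : x \in [seq f i | i <- enum 'I_k] by rewrite -(perm_mem peq) mem_head.
case/mapP => i0 _ xE; exists i0, l; split => // [i ii0|z zl]; last first.
  exact: le_trans (yl _ zl) yx.
have : perm_eq (y :: l) [seq f i | i <- rem i0 (enum 'I_k)].
  rewrite -(perm_cons x); apply: perm_trans peq _; rewrite xE -map_cons.
  by apply: perm_map; apply: perm_to_rem; rewrite mem_enum.
move/perm_mem/(_ (f i)) => mem.
have : f i \in y :: l.
  rewrite mem; apply: map_f; rewrite mem_rem_uniq ?enum_uniq // inE /= mem_enum.
  by rewrite ii0.
by rewrite inE => /predU1P[->//|/yl].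
Qed.

(** The largest eigenvalue of [A^T *m A] is real and has a real eigenvector [e].
    If it is simple, then only one vector of the unitary basis is not orthogonal
    to [e], so that the real vectors orthogonal to [e] only involve the other
    eigenvalues; if it is not simple, then the two singular values agree. *)
Lemma top_singular A (s1 := singular_value 1 A) (s2 := singular_value 2 A) :
  [/\ 0 <= s2, s2 <= s1,
      forall v, enorm (A *m v) <= s1 * enorm v,
      `|\det A| <= s1 ^+ n.+1 * s2
    & exists e, [/\ enorm e = 1, A^T *m A *m e = s1 ^+ 2 *: e &
        forall v, dot v e = 0 -> enorm (A *m v) <= s2 * enorm v]].
Proof.
have [d [w [d0 [peq wZ wdot wA wH]]]] := gram_spectral A.
have peqs := singular_values_perm peq.
have [i0 [l [svE fi0 fi s21 ls1]]] := singular_values_split peqs.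
rewrite -/s1 -/s2 in svE fi0 fi s21 ls1.
have ge0 x : x \in singular_values A -> 0 <= x.
  by rewrite (perm_mem peqs) => /mapP[i _ ->]; rewrite sqrtr_ge0.
have s20 : 0 <= s2 by apply: ge0; rewrite svE !inE eqxx orbT.
have s10 : 0 <= s1 by apply: le_trans s21.
have dfi i : d i = Num.sqrt (d i) ^+ 2 by rewrite sqr_sqrtr.
have di0 : d i0 = s1 ^+ 2 by rewrite dfi fi0.
have dle i : d i <= s1 ^+ 2.
  rewrite dfi lerXn2r ?nnegrE ?sqrtr_ge0 //.
  by have [->|/fi/le_trans->//] := eqVneq i i0; rewrite fi0.
have bound v (c : R) : 0 <= c -> (forall i, d i <= c ^+ 2 \/ w v i = 0) ->
    enorm (A *m v) <= c * enorm v.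
  move=> c0 dc; rewrite -(@ler_pXn2r _ 2) ?nnegrE ?mulr_ge0 ?enorm_ge0 //.
  rewrite exprMn !enorm_sqr -lecR rmorphM /= -wA -wdot mulr_sumr.
  apply: ler_sum => i _; case: (dc i) => [di|->]; last by rewrite !mulr0.
  by apply: ler_wpM2r; rewrite ?lecR // mulrC mul_conjC_ge0.
split => //.
- by move=> v; apply: bound => // i; left.
- rewrite -prod_singular_values svE !big_cons exprS -mulrA; apply: ler_wpM2l => //.
  rewrite mulrC; apply: ler_wpM2r => //.
  have szl : size l = n.
    by have := perm_size peqs; rewrite svE size_map size_enum_ord /= => -[].
  have gel x : x \in l -> 0 <= x by move=> xl; apply: ge0; rewrite svE !inE xl !orbT.
  rewrite -szl; elim: (l) ls1 gel => [|x l' IH] le ge; first by rewrite big_nil expr0.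
  rewrite big_cons /= exprS; apply: ler_pM.
  + by apply: ge; rewrite mem_head.
  + by rewrite big_seq; apply: prodr_ge0 => y yl; apply: ge; rewrite inE yl orbT.
  + by apply: le; rewrite mem_head.
  + by apply: IH => y yl; [apply: le|apply: ge]; rewrite inE yl orbT.
- have : eigenvalue (A^T *m A) (s1 ^+ 2).
    rewrite eigenvalue_root_char -(fmorph_root (real_complex R)) map_char_poly.
    rewrite -/(complex_mx _) char_poly_spectrum root_prod_XsubC (perm_mem peq) -di0.
    by apply/mapP; exists i0; rewrite ?mem_enum.
  case/eigenvalueP => r rE r0.
  pose e := (enorm r^T)^-1 *: r^T.
  have er0 : enorm r^T != 0.
    by apply: contra r0 => /eqP/enorm_eq0/(congr1 trmx); rewrite trmxK trmx0 => ->.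
  have e1 : enorm e = 1.
    by rewrite /e enormZ ger0_norm ?invr_ge0 ?enorm_ge0 // mulVf.
  have eE : A^T *m A *m e = s1 ^+ 2 *: e.
    rewrite /e -scalemxAr scalerA mulrC -scalerA; congr (_ *: _).
    by apply: trmx_inj; rewrite !trmx_mul !trmxK linearZ /= trmxK.
  exists e; split => // v ve.
  have [s12|s12] := eqVneq s1 s2.
    by apply: bound => // i; left; rewrite -s12.
  have lt21 : s2 < s1 by rewrite lt_def s12.
  have we i : i != i0 -> w e i = 0.
    move=> ii0; have := wH e i; rewrite eE wZ => /eqP.
    rewrite -subr_eq0 -mulrBl mulf_eq0 => /orP[|/eqP//].
    rewrite -rmorphB /= => /eqP/(@complexI R _ 0)/eqP.
    rewrite subr_eq0 dfi eqrXn2 ?sqrtr_ge0 // => /eqP s1E.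
    by have := fi i ii0; rewrite -s1E leNgt lt21.
  have wei0 : w e i0 != 0.
    apply/eqP => we0; have := wdot e e.
    rewrite big1 => [|i _]; last by have [->|/we->] := eqVneq i i0; rewrite ?we0 mulr0.
    rewrite -enorm_sqr e1 expr1n => /esym/eqP.
    by rewrite (oner_eq0 R[i]).
  apply: bound => // i; have [->|/fi fis] := eqVneq i i0; [right|left]; last first.
    by rewrite dfi lerXn2r ?nnegrE ?sqrtr_ge0.
  have := wdot e v; rewrite (bigD1 i0) //= big1 ?addr0; last first.
    by move=> j /we->; rewrite conjC0 mul0r.
  rewrite dotC ve => /eqP; rewrite mulf_eq0 conjC_eq0 (negPf wei0) /= => /eqP//.
Qed.
End TopSingular.

(** * Angles between lines and the leading rank one part of a matrix *)

Section Perp.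
Variables (R : realType) (k : nat).
Implicit Types x y z : 'cV[R]_k.

(** For unit vectors, the sine of the angle between the lines they span. *)
Definition perp_dist x y : R := enorm (x - dot x y *: y).

Lemma perp_dist_sqr x y : enorm y = 1 -> perp_dist x y ^+ 2 = enorm x ^+ 2 - dot x y ^+ 2.
Proof.
move=> y1; rewrite !enorm_sqr !(dotDl, dotDr, dotNl, dotNr, dotZl, dotZr).
by rewrite [dot y x]dotC -[dot y y]enorm_sqr y1 expr1n; ring.
Qed.

Lemma perp_dist_le x y : enorm y = 1 -> perp_dist x y <= enorm x.
Proof.
move=> y1; rewrite -(@ler_pXn2r _ 2) ?nnegrE ?enorm_ge0 // perp_dist_sqr //.
by rewrite gerBl sqr_ge0.
Qed.

Lemma perp_distC x y : enorm x = 1 -> enorm y = 1 -> perp_dist x y = perp_dist y x.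
Proof.
move=> x1 y1; apply/eqP; rewrite -(@eqrXn2 _ 2) ?enorm_ge0 // !perp_dist_sqr //.
by rewrite x1 y1 [dot y x]dotC.
Qed.

Lemma dot_unit_le1 x y : enorm x = 1 -> enorm y = 1 -> `|dot x y| <= 1.
Proof. by move=> x1 y1; have := cauchy_schwarz x y; rewrite x1 y1 mulr1. Qed.

Lemma perp_dist_triangle x y z : enorm x = 1 -> enorm y = 1 -> enorm z = 1 ->
  perp_dist x z <= perp_dist x y + perp_dist y z.
Proof.
move=> x1 y1 z1; rewrite {1}/perp_dist.
have -> : x - dot x z *: z =
    dot x y *: (y - dot y z *: z) +
    ((x - dot x y *: y) - dot (x - dot x y *: y) z *: z).
  rewrite dotDl dotNl dotZl; apply/matrixP => i j; rewrite !mxE; ring.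
apply: le_trans (enormD _ _) _; rewrite addrC; apply: lerD.
  exact: perp_dist_le.
by rewrite enormZ ler_piMl ?enorm_ge0 ?dot_unit_le1.
Qed.

Lemma dot_perp_dist x x' y : enorm x' = 1 -> enorm y = 1 -> enorm x = 1 ->
  `|dot x y| <= `|dot x' y| + perp_dist x x'.
Proof.
move=> x1 y1 z1.
have -> : dot x y = dot x x' * dot x' y + dot (x - dot x x' *: x') y.
  by rewrite dotDl dotNl dotZl; ring.
apply: le_trans (ler_normD _ _) _; apply: lerD.
  by rewrite normrM ler_piMl ?dot_unit_le1.
by apply: le_trans (cauchy_schwarz _ _) _; rewrite y1 mulr1.
Qed.
End Perp.

Section RankOnePart.
Variables (R : realType) (n : nat).
Local Notation k := n.+2.
Implicit Types A T : 'M[R]_k.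

(** [A] is [s1] times the rank one operator from the line of [e] to the line
    of [u], up to an operator between the orthogonal hyperplanes, which has
    norm at most [s2]. *)
Record rank_one_part A (s1 s2 : R) (u e : 'cV[R]_k) : Prop := RankOnePart {
  rop_ge0 : 0 <= s2;
  rop_u : enorm u = 1;
  rop_e : enorm e = 1;
  rop_image : A *m e = s1 *: u;
  rop_coimage : A^T *m u = s1 *: e;
  rop_norm : forall v, enorm (A *m v) <= s1 * enorm v;
  rop_tnorm : forall v, enorm (A^T *m v) <= s1 * enorm v;
  rop_perp : forall v, dot v e = 0 -> enorm (A *m v) <= s2 * enorm v;
  rop_tperp : forall v, dot v u = 0 -> enorm (A^T *m v) <= s2 * enorm v }.

Lemma rank_one_part_tr A s1 s2 u e :
  rank_one_part A s1 s2 u e -> rank_one_part A^T s1 s2 e u.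
Proof. by case=> *; split; rewrite ?trmxK. Qed.

Lemma rank_one_part_exists A : 0 < singular_value 1 A -> exists u e,
  rank_one_part A (singular_value 1 A) (singular_value 2 A) u e.
Proof.
move=> s10; have [s20 s21 norm _ [e [e1 eE perp]]] := top_singular A.
set s1 := singular_value 1 A in s10 s21 norm eE *.
set s2 := singular_value 2 A in s20 s21 perp *.
have adj_norm (c : R) v : 0 <= c ->
   enorm (A *m (A^T *m v)) <= c * enorm (A^T *m v) -> enorm (A^T *m v) <= c * enorm v.
  move=> c0 h; set y := A^T *m v in h *; have [->|y0] := eqVneq (enorm y) 0.
    by rewrite mulr_ge0 ?enorm_ge0.
  have yp : 0 < enorm y by rewrite lt_def y0 enorm_ge0.
  rewrite -(ler_pM2r yp) -expr2 enorm_sqr {1}/y dot_adj trmxK mulrAC [leRHS]mulrC.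
  apply: le_trans (ler_norm _) _; apply: le_trans (cauchy_schwarz _ _) _.
  by apply: ler_wpM2l; rewrite ?enorm_ge0.
exists (s1^-1 *: (A *m e)), e.
have Ae : enorm (A *m e) = s1.
  rewrite -[RHS]ger0_norm ?ltW // -[RHS]sqrtr_sqr /enorm dot_adj mulmxA eE dotZr.
  by rewrite -enorm_sqr e1 expr1n mulr1.
have s1n : s1 != 0 by rewrite lt0r_neq0.
split => //.
- by rewrite enormZ Ae ger0_norm ?mulVf // invr_ge0 ltW.
- by rewrite scalerA mulfV // scale1r.
- by rewrite -scalemxAr mulmxA eE scalerA expr2 mulrA mulVf // mul1r.
- by move=> v; apply: adj_norm => //; rewrite ltW.
- move=> v vu; apply: adj_norm => //; apply: perp.
  rewrite dotC -dot_adj dotC; apply/eqP.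
  by move/eqP: vu; rewrite dotZr mulf_eq0 invr_eq0 (negPf s1n).
Qed.

Lemma rank_one_part_decomp A s1 s2 u e v : rank_one_part A s1 s2 u e ->
  exists2 w, A *m v = (s1 * dot v e) *: u + w & enorm w <= s2 * enorm v /\ dot w u = 0.
Proof.
case=> s20 u1 e1 Ae Au nA ntA pA ptA; exists (A *m (v - dot v e *: e)).
  by rewrite mulmxBr -scalemxAr Ae scalerA mulrC addrC subrK.
have ve0 : dot (v - dot v e *: e) e = 0.
  by rewrite dotDl dotNl dotZl -[dot e e]enorm_sqr e1 expr1n mulr1 subrr.
split; last by rewrite dot_adj Au dotZr ve0 mulr0.
apply: le_trans (pA _ ve0) _; by apply: ler_wpM2l => //; apply: perp_dist_le.
Qed.

(** The part of [A] between the hyperplanes is what moves images away from the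
    line of [u]. *)
Lemma perp_dist_image A s1 s2 u e v : rank_one_part A s1 s2 u e ->
  perp_dist (A *m v) u <= s2 * enorm v.
Proof.
move=> rA; have [w -> [wle wu]] := rank_one_part_decomp v rA.
rewrite /perp_dist dotDl dotZl -[dot u u]enorm_sqr (rop_u rA) expr1n mulr1 wu.
by rewrite addr0 addrC addKr.
Qed.

(** The direction that the product expands most is proportional to an image under
    [A^T], and these are close to the line of [e] when [A] has a large gap. *)
Lemma perp_dist_extend A T s1 s2 u e s1' s2' u' e' B :
  rank_one_part A s1 s2 u e -> rank_one_part (T *m A) s1' s2' u' e' ->
  0 < s1 -> 0 <= B -> (forall v, enorm (T^T *m v) <= B * enorm v) -> s1 <= B * s1' ->
  perp_dist e' e <= B ^+ 2 * (s2 / s1).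
Proof.
move=> rA rTA s10 B0 TB s1B.
have s1'0 : 0 < s1'.
  rewrite ltNge; apply/negP => s1'0; have := lt_le_trans s10 s1B.
  by rewrite ltNge mulr_ge0_le0.
have -> : e' = A^T *m (s1'^-1 *: (T^T *m u')).
  rewrite -scalemxAr mulmxA -trmx_mul (rop_coimage rTA) scalerA mulVf ?scale1r //.
  by rewrite lt0r_neq0.
apply: le_trans (perp_dist_image _ (rank_one_part_tr rA)) _.
have inv : s1'^-1 <= B / s1.
  by rewrite ler_pdivlMr // ler_pdivrMl // mulrC.
rewrite enormZ ger0_norm ?invr_ge0 ?(ltW s1'0) //.
have TBu : enorm (T^T *m u') <= B by have := TB u'; rewrite (rop_u rTA) mulr1.
have -> : B ^+ 2 * (s2 / s1) = s2 * (B / s1 * B) by ring.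
apply: ler_wpM2l; first exact: rop_ge0 rA.
by apply: ler_pM; rewrite ?enorm_ge0 ?invr_ge0 ?(ltW s1'0).
Qed.

Lemma norm_product_lower A A' s1 s2 u e s1' s2' u' e' s :
  rank_one_part A s1 s2 u e -> rank_one_part A' s1' s2' u' e' ->
  0 <= s1 -> 0 <= s1' ->
  (forall v, enorm (A *m A' *m v) <= s * enorm v) ->
  s1 * s1' * `|dot e u'| <= s.
Proof.
move=> rA rA' s10 s1'0 sP.
have := cauchy_schwarz u (A *m A' *m e').
rewrite -mulmxA (rop_image rA') -scalemxAr dotZr dotC dot_adj (rop_coimage rA).
rewrite dotZr dotC (rop_u rA) mul1r !normrM (ger0_norm s10) (ger0_norm s1'0).
rewrite mulrCA mulrA dotC => /le_trans; apply.
by have := sP e'; rewrite -mulmxA (rop_image rA') -scalemxAr (rop_e rA') mulr1.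
Qed.

(** Only the parts of the two factors of rank one matter: the other parts are
    relatively small when both factors have a large gap. *)
Lemma norm_product_upper A A' s1 s2 u e s1' s2' u' e' v :
  rank_one_part A s1 s2 u e -> rank_one_part A' s1' s2' u' e' ->
  0 < s1 -> 0 < s1' ->
  enorm (A *m A' *m v) <=
    s1 * s1' * (`|dot e u'| + s2 / s1 + s2' / s1') * enorm v.
Proof.
move=> rA rA' s10 s1'0; rewrite -mulmxA.
have [w -> [wle wu]] := rank_one_part_decomp v rA'.
rewrite mulmxDr -scalemxAr; apply: le_trans (enormD _ _) _.
rewrite enormZ normrM (ger0_norm (ltW s1'0)).
have Au' : enorm (A *m u') <= s1 * `|dot e u'| + s2.
  have [w' -> [w'le w'u]] := rank_one_part_decomp u' rA.
  apply: le_trans (enormD _ _) _; rewrite enormZ (rop_u rA) mulr1 normrM.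
  by rewrite (ger0_norm (ltW s10)) dotC lerD2l (le_trans w'le) // (rop_u rA') mulr1.
have dv : `|dot v e'| <= enorm v.
  by have := cauchy_schwarz v e'; rewrite (rop_e rA') mulr1.
have Aw : enorm (A *m w) <= s1 * (s2' * enorm v).
  by apply: le_trans (rop_norm rA _) _; apply: ler_wpM2l; rewrite ?(ltW s10).
have -> : s1 * s1' * (`|dot e u'| + s2 / s1 + s2' / s1') * enorm v =
  s1' * enorm v * (s1 * `|dot e u'| + s2) + s1 * (s2' * enorm v).
  by field; rewrite !lt0r_neq0.
apply: lerD => //; apply: ler_pM; rewrite ?enorm_ge0 ?mulr_ge0 ?(ltW s1'0) //.
by apply: ler_wpM2l; rewrite ?(ltW s1'0).
Qed.
End RankOnePart.

(** * Quasi-multiplicativity along dominated chains *)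

Section FirstSingularValue.
Variables (R : realType) (n : nat).
Local Notation k := n.+2.
Implicit Types A : 'M[R]_k.

Lemma enorm_singular1 A v : enorm (A *m v) <= singular_value 1 A * enorm v.
Proof. by have [_ _ + _ _] := top_singular A; apply. Qed.

Lemma singular1_le A c :
  (forall v, enorm (A *m v) <= c * enorm v) -> singular_value 1 A <= c.
Proof.
move=> Ac; have [s20 s21 _ _ [e [e1 eE _]]] := top_singular A.
have := Ac e; rewrite e1 mulr1; apply: le_trans.
have s10 := le_trans s20 s21.
rewrite -[leLHS](ger0_norm s10) -sqrtr_sqr /enorm dot_adj mulmxA eE dotZr.
by rewrite -enorm_sqr e1 expr1n mulr1.
Qed.

Lemma singular1_ge0 A : 0 <= singular_value 1 A.
Proof. by have [s20 s21 _ _ _] := top_singular A; apply: le_trans s21. Qed.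

Lemma singular1_mul A A' :
  singular_value 1 (A *m A') <= singular_value 1 A * singular_value 1 A'.
Proof.
apply: singular1_le => v; rewrite -mulmxA.
apply: le_trans (enorm_singular1 _ _) _; rewrite -mulrA.
by apply: ler_wpM2l; rewrite ?singular1_ge0 ?enorm_singular1.
Qed.
End FirstSingularValue.

Opaque singular_value.

Section DominatedChain.
Variables (R : realType) (n : nat).
Local Notation k := n.+2.
Local Notation sv := singular_value.

(** [M i j] plays the role of the product of the matrices number [i] to [j - 1]
    of a sequence of [N] matrices, all products of consecutive ones having a
    singular value gap exponential in their length. *)
Definition dominated_chain (B G q : R) (N : nat) (M : nat -> nat -> 'M[R]_k) : Prop :=
  [/\ (forall i, M i i = 1%:M) /\
      (forall i l j, (i <= l <= j)%N -> (j <= N)%N -> M i j = M i l *m M l j),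
      forall i j, (i <= j <= N)%N ->
        1 <= sv 1 (M i j) /\ sv 2 (M i j) <= G * q ^+ (j - i) * sv 1 (M i j),
      forall i, (i < N)%N -> sv 1 (M i i.+1) <= B,
      forall i j, (i < j <= N)%N -> sv 1 (M i.+1 j) <= B * sv 1 (M i j)
    & forall i j, (i <= j < N)%N -> sv 1 (M i j) <= B * sv 1 (M i j.+1)].

Section Chain.
Variables (B G q : R) (N : nat) (M : nat -> nat -> 'M[R]_k).
Hypotheses (B1 : 1 <= B) (G0 : 0 <= G) (q0 : 0 < q) (q1 : q < 1).
Hypothesis chainM : dominated_chain B G q N M.

Let B0 : 0 <= B. Proof. exact: le_trans B1. Qed.

Lemma chain_pos i j : (i <= j <= N)%N -> 0 < sv 1 (M i j).
Proof. by case: chainM => _ h _ _ _ /h[h1 _]; apply: lt_le_trans h1. Qed.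

Lemma chain_ratio i j : (i <= j <= N)%N -> sv 2 (M i j) / sv 1 (M i j) <= G * q ^+ (j - i).
Proof.
by move=> ij; rewrite ler_pdivrMr ?chain_pos //; case: chainM => _ /(_ _ _ ij)[].
Qed.

Lemma chain_directions : exists ue : nat * nat -> 'cV[R]_k * 'cV[R]_k,
  forall i j, (i <= j <= N)%N ->
  rank_one_part (M i j) (sv 1 (M i j)) (sv 2 (M i j)) (ue (i, j)).1 (ue (i, j)).2.
Proof.
have /choice[ue ueP] : forall ij : nat * nat, exists ue : 'cV[R]_k * 'cV[R]_k,
    (ij.1 <= ij.2 <= N)%N -> rank_one_part (M ij.1 ij.2)
       (sv 1 (M ij.1 ij.2)) (sv 2 (M ij.1 ij.2)) ue.1 ue.2.
  move=> [i j] /=; case ijN : (i <= j <= N)%N; last by exists (0, 0).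
  by have [u [e ueP]] := rank_one_part_exists (chain_pos ijN); exists (u, e).
by exists ue => i j ij; apply: (ueP (i, j)).
Qed.

Variable ue : nat * nat -> 'cV[R]_k * 'cV[R]_k.
Hypothesis ueP : forall i j, (i <= j <= N)%N ->
  rank_one_part (M i j) (sv 1 (M i j)) (sv 2 (M i j)) (ue (i, j)).1 (ue (i, j)).2.
Local Notation U i j := (ue (i%N, j%N)).1.
Local Notation E i j := (ue (i%N, j%N)).2.

Let drift a r : B ^+ 2 * G * (q ^+ a - q ^+ (a + r)) / (1 - q) + B ^+ 2 * (G * q ^+ (a + r))
  = B ^+ 2 * G * (q ^+ a - q ^+ (a + r.+1)) / (1 - q).
Proof.
have : 1 - q != 0 by rewrite subr_eq0 eq_sym lt_eqF.
by move=> h; rewrite addnS [q ^+ _.+1]exprS; move: (q ^+ a) (q ^+ (a + r)) => x y; field.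
Qed.

Let drift_le a r : B ^+ 2 * G * (q ^+ a - q ^+ (a + r)) / (1 - q) <=
   B ^+ 2 * G / (1 - q) * q ^+ a.
Proof.
rewrite mulrAC; apply: ler_wpM2l; last by rewrite gerBl exprn_ge0 // ltW.
by rewrite mulr_ge0 ?invr_ge0 ?subr_ge0 ?(ltW q1) // mulr_ge0 // exprn_ge0.
Qed.

Let perp_dist_refl (x : 'cV[R]_k) : enorm x = 1 -> perp_dist x x = 0.
Proof.
move=> x1; rewrite /perp_dist -[dot x x]enorm_sqr x1 expr1n scale1r subrr.
by rewrite -[X in enorm X](scale0r 0) enormZ normr0 mul0r.
Qed.

(** The gaps being exponential, the successive changes of direction add up to a
    geometric series. *)
Lemma expanded_direction_drift i t j : (i <= t <= j)%N -> (j <= N)%N ->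
  perp_dist (E i j) (E t j) <= B ^+ 2 * G / (1 - q) * q ^+ (j - t).
Proof.
move=> /andP[it tj] jN.
suff gen r : (r <= t)%N -> perp_dist (E (t - r) j) (E t j) <=
    B ^+ 2 * G * (q ^+ (j - t) - q ^+ (j - t + r)) / (1 - q).
  apply: le_trans (drift_le _ (t - i)).
  by have := gen (t - i)%N (leq_subr _ _); rewrite subKn.
elim: r => [|r IH] rt.
  have tjN : (t <= j <= N)%N by rewrite tj.
  by rewrite subn0 addn0 subrr mulr0 mul0r perp_dist_refl // (rop_e (ueP tjN)).
have ltr : (t - r.+1 < t - r)%N by lia.
have rj : (t - r <= j <= N)%N by lia.
have rj' : (t - r.+1 <= j <= N)%N by lia.
have tjN : (t <= j <= N)%N by lia.
have rS : (t - r = (t - r.+1).+1)%N by lia.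
apply: le_trans (perp_dist_triangle (rop_e (ueP rj')) (rop_e (ueP rj)) (rop_e (ueP tjN))) _.
rewrite -drift addrC; apply: lerD; first by apply: IH; lia.
case: chainM => -[_ cut] _ letter left _.
have split : M (t - r.+1) j = M (t - r.+1) (t - r) *m M (t - r) j by apply: cut; lia.
have ext := @perp_dist_extend _ _ _ (M (t - r.+1) (t - r)) _ _ _ _ _ _ _ _ B (ueP rj).
rewrite -split in ext.
apply: le_trans (ext _ _ _ _ (ueP rj') _ _ _ _) _ => //.
- exact: chain_pos.
- move=> v; have lt1 : (t - r.+1 <= t - r <= N)%N by lia.
  apply: le_trans (rop_tnorm (ueP lt1) v) _; apply: ler_wpM2r; rewrite ?enorm_ge0 //.
  by rewrite rS; apply: letter; lia.
- by rewrite {1}rS; apply: left; lia.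
- apply: ler_wpM2l; first exact: exprn_ge0.
  by apply: le_trans (chain_ratio rj) _; have -> : (j - (t - r) = j - t + r)%N by lia.
Qed.

Lemma image_direction_drift i t j : (i <= t <= j)%N -> (j <= N)%N ->
  perp_dist (U i j) (U i t) <= B ^+ 2 * G / (1 - q) * q ^+ (t - i).
Proof.
move=> /andP[it tj] jN.
suff gen r : (t + r <= N)%N -> perp_dist (U i (t + r)) (U i t) <=
    B ^+ 2 * G * (q ^+ (t - i) - q ^+ (t - i + r)) / (1 - q).
  apply: le_trans (drift_le _ (j - t)).
  by have := gen (j - t)%N; rewrite subnKC //; apply.
elim: r => [|r IH] rN.
  have itN : (i <= t <= N)%N by lia.
  by rewrite addn0 addn0 subrr mulr0 mul0r perp_dist_refl // (rop_u (ueP itN)).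
have ri : (i <= t + r <= N)%N by lia.
have ri' : (i <= t + r.+1 <= N)%N by lia.
have itN : (i <= t <= N)%N by lia.
apply: le_trans (perp_dist_triangle (rop_u (ueP ri')) (rop_u (ueP ri)) (rop_u (ueP itN))) _.
rewrite -drift addrC; apply: lerD; first by apply: IH; lia.
case: chainM => -[_ cut] _ letter _ right.
have split : (M i (t + r.+1))^T = (M (t + r) (t + r.+1))^T *m (M i (t + r))^T.
  by rewrite -trmx_mul; congr (_^T); apply: cut; lia.
have ext := @perp_dist_extend _ _ _ (M (t + r) (t + r.+1))^T _ _ _ _ _ _ _ _ B
  (rank_one_part_tr (ueP ri)).
rewrite -split in ext.
apply: le_trans (ext _ _ _ _ (rank_one_part_tr (ueP ri')) _ _ _ _) _ => //.
- exact: chain_pos.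
- move=> v; rewrite trmxK; apply: le_trans (enorm_singular1 _ v) _.
  by apply: ler_wpM2r; rewrite ?enorm_ge0 // addnS; apply: letter; lia.
- by rewrite addnS; apply: right; lia.
- apply: ler_wpM2l; first exact: exprn_ge0.
  by apply: le_trans (chain_ratio ri) _; have -> : (t + r - i = t - i + r)%N by lia.
Qed.

Lemma chain_shift_left i t r : (i <= t)%N -> (t + r <= N)%N ->
  sv 1 (M i t) <= B ^+ r * sv 1 (M i (t + r)).
Proof.
case: chainM => _ _ _ _ right it.
elim: r => [|r IH] rN; first by rewrite addn0 expr0 mul1r.
apply: le_trans (IH _) _; first by lia.
rewrite exprSr -mulrA; apply: ler_wpM2l; first exact: exprn_ge0.
by rewrite addnS; apply: right; lia.
Qed.

Lemma chain_shift_right t r : (t + r <= N)%N ->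
  sv 1 (M t N) <= B ^+ r * sv 1 (M (t + r) N).
Proof.
case: chainM => -[_ cut] _ letter _ _; elim: r => [|r IH] rN.
  by rewrite addn0 expr0 mul1r.
apply: le_trans (IH _) _; first by lia.
rewrite exprSr -mulrA; apply: ler_wpM2l; first exact: exprn_ge0.
rewrite (cut (t + r)%N (t + r).+1 N) ?addnS; try lia.
apply: le_trans (singular1_mul _ _) _; apply: ler_wpM2r; first exact: singular1_ge0.
by apply: letter; lia.
Qed.

Definition drift_const : R := B ^+ 2 * G / (1 - q) + G.

Lemma drift_const_ge0 : 0 <= drift_const.
Proof.
by rewrite addr_ge0 // mulr_ge0 ?invr_ge0 ?subr_ge0 ?(ltW q1) // mulr_ge0 // exprn_ge0.
Qed.

(** The defect of multiplicativity at a cut is read on the angle between the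
    direction that the left part expands and the one that the right part reaches.
    For a short window around the cut these directions already agree with those
    of the whole chain, up to exponentially small errors. *)
Lemma chain_window_defect i tau j : (i <= tau <= j)%N -> (j <= N)%N ->
  sv 1 (M i j) <= sv 1 (M i tau) * sv 1 (M tau j) *
    (sv 1 (M 0 N) / (sv 1 (M 0 tau) * sv 1 (M tau N)) +
     drift_const * (q ^+ (tau - i) + q ^+ (j - tau))).
Proof.
move=> ij jN.
have iN : (i <= tau <= N)%N by lia.
have Nj : (tau <= j <= N)%N by lia.
have l0 : (0 <= tau <= N)%N by lia.
have rN : (tau <= N <= N)%N by lia.
have cut i' j' : (i' <= tau <= j')%N -> (j' <= N)%N -> M i' j' = M i' tau *m M tau j'.
  by case: chainM => -[_ cut] _ _ _ _; apply: cut.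
apply: singular1_le => v; rewrite (cut i j) //.
apply: le_trans (norm_product_upper _ (ueP iN) (ueP Nj) _ _) _; rewrite ?chain_pos //.
apply: ler_wpM2r; first exact: enorm_ge0.
apply: ler_wpM2l; first by rewrite mulr_ge0 ?singular1_ge0.
have dot_le : `|dot (E i tau) (U tau j)| <=
    `|dot (E 0 tau) (U tau N)| + perp_dist (E 0 tau) (E i tau)
       + perp_dist (U tau N) (U tau j).
  have e1 := rop_e (ueP l0); have e2 := rop_e (ueP iN).
  have u1 := rop_u (ueP rN); have u2 := rop_u (ueP Nj).
  apply: le_trans (dot_perp_dist e1 u2 e2) _; rewrite perp_distC // addrAC lerD2r.
  rewrite dotC; apply: le_trans (dot_perp_dist u1 e1 u2) _.
  by rewrite dotC perp_distC.
have whole : `|dot (E 0 tau) (U tau N)| <=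
    sv 1 (M 0 N) / (sv 1 (M 0 tau) * sv 1 (M tau N)).
  rewrite ler_pdivlMr ?mulr_gt0 ?chain_pos // mulrC.
  apply: (norm_product_lower (ueP l0) (ueP rN)); rewrite ?singular1_ge0 //.
  by move=> w; rewrite -cut ?enorm_singular1 //; lia.
have := expanded_direction_drift (i := 0%N) (t := i) (j := tau).
have := image_direction_drift (i := tau) (t := j) (j := N).
move=> /(_ _ _)/[swap] /(_ _ _) d1 d2.
have {}d1 : perp_dist (E 0 tau) (E i tau) <= B ^+ 2 * G / (1 - q) * q ^+ (tau - i).
  by apply: d1; [case/andP: ij|case/andP: iN].
have {}d2 : perp_dist (U tau N) (U tau j) <= B ^+ 2 * G / (1 - q) * q ^+ (j - tau).
  by apply: d2; [rewrite jN; case/andP: ij => _ ->|].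
have r1 := chain_ratio iN; have r2 := chain_ratio Nj.
set X := B ^+ 2 * G / (1 - q) in d1 d2.
have -> : drift_const * (q ^+ (tau - i) + q ^+ (j - tau)) =
    X * q ^+ (tau - i) + X * q ^+ (j - tau) + G * q ^+ (tau - i) + G * q ^+ (j - tau).
  by rewrite /drift_const -/X; move: (q ^+ _) (q ^+ _) (X) => x y z; ring.
rewrite !addrA; apply: lerD r2; apply: lerD r1; apply: le_trans dot_le _.
by apply: lerD d2; apply: lerD d1.
Qed.
End Chain.

(** At a cut with a defect larger than [Q], and hence at all the next [H] cuts,
    the alignment of the expanded directions is so bad that each window of length
    [2 ^ c.+1] near the cut has, at its middle, a defect exponential in [2 ^ c].
    Doubling the windows from length 1 to length [H], the gain in the exponent is
    proportional to [2 ^ c * c], which finally makes a first singular value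
    smaller than 1. *)
Lemma dominated_chain_quasi_multiplicative (B G p : R) :
  1 <= B -> 0 <= G -> 0 < p < 1 -> exists2 Q, 0 < Q &
    forall N M, dominated_chain B G (p ^+ 2) N M -> forall t, (t <= N)%N ->
      sv 1 (M 0%N t) * sv 1 (M t N) <= Q * sv 1 (M 0%N N).
Proof.
move=> B1 G0 /andP[p0 p1]; set q := p ^+ 2.
have B0 : 0 < B by apply: lt_le_trans B1.
have q0 : 0 < q by rewrite exprn_gt0.
have q1 : q < 1 by rewrite exprn_ilt1 // ltW.
pose K := drift_const B G q.
have K0 : 0 <= K by apply: drift_const_ge0.
pose C := 2 + 2 * K.
have C1 : 1 < C by rewrite /C; lra.
have C0 : 0 < C by apply: lt_trans C1.
have [b bP] : exists b, B * C * p ^+ b <= 1.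
  have pn : `|p| < 1 by rewrite gtr0_norm.
  have /cvgr0Pnorm_lt/(_ 1 ltr01)[b _ /(_ b (leqnn b))] := cvg_geometric (B * C) pn.
  by rewrite /= => /ltW/(le_trans (ler_norm _)) => ?; exists b.
have [H HE] : exists H, H = (2 ^ b)%N by exists (2 ^ b)%N.
exists (B ^+ (2 * H) / q ^+ H); first by rewrite divr_gt0 ?exprn_gt0.
move=> N M chainM t tN; rewrite leNgt; apply/negP => defect.
have cpos := chain_pos chainM.
have Q1 r : (r <= H)%N -> B ^+ (2 * r) <= B ^+ (2 * H) / q ^+ H.
  move=> rH; rewrite ler_pdivlMr ?exprn_gt0 //.
  apply: (@le_trans _ _ (B ^+ (2 * r))).
    by rewrite ler_piMr ?exprn_ge0 ?exprn_ile1 // ltW.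
  by apply: ler_weXn2l; rewrite ?leq_mul2l.
have tHN : (t + H <= N)%N.
  rewrite leqNgt; apply/negP => NtH; move: defect; apply/negP; rewrite -leNgt.
  have tNN : (t + (N - t) <= N)%N by rewrite subnKC.
  have left := chain_shift_left B1 G0 q0 q1 chainM (leq0n t) tNN.
  have right := chain_shift_right B1 G0 q0 q1 chainM tNN.
  rewrite (subnKC tN) in left right.
  have MNN : sv 1 (M N N) <= 1.
    case: chainM => -[-> _] _ _ _ _; apply: singular1_le => v.
    by rewrite mul1mx mul1r.
  have := ler_pM (singular1_ge0 _) (singular1_ge0 _) left right; move/le_trans; apply.
  rewrite mulrACA -exprD addnn -mul2n.
  have Nt : (N - t <= H)%N by rewrite leq_subLR ltnW.
  apply: (@le_trans _ _ (B ^+ (2 * (N - t)) * sv 1 (M 0%N N))).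
    apply: ler_wpM2l; first by rewrite exprn_ge0 // ltW.
    by rewrite ler_piMr ?singular1_ge0.
  by apply: ler_wpM2r; [apply: singular1_ge0|apply: Q1].
have whole r : (r <= H)%N ->
    sv 1 (M 0%N N) / (sv 1 (M 0%N (t + r)%N) * sv 1 (M (t + r)%N N)) <= q ^+ H.
  move=> rH; have trN : (t + r <= N)%N by clear -tHN rH; lia.
  have left := chain_shift_left B1 G0 q0 q1 chainM (leq0n t) trN.
  have right := chain_shift_right B1 G0 q0 q1 chainM trN.
  have pos : 0 < sv 1 (M 0%N (t + r)%N) * sv 1 (M (t + r)%N N).
    by rewrite mulr_gt0 ?cpos ?trN ?leq0n ?leqnn.
  have prod := ler_pM (singular1_ge0 _) (singular1_ge0 _) left right.
  have := lt_le_trans defect prod; rewrite mulrACA -exprD addnn -mul2n => lt.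
  have BH : 0 < B ^+ (2 * H) by rewrite exprn_gt0.
  have qH : 0 < q ^+ H by rewrite exprn_gt0.
  have le : B ^+ (2 * r) <= B ^+ (2 * H) by apply: ler_weXn2l; rewrite ?leq_mul2l.
  rewrite (ler_pdivrMr _ _ pos) -(ler_pM2l BH).
  have {le} := le_trans (ltW lt) (ler_wpM2r (ltW pos) le).
  by rewrite mulrAC (ler_pdivrMr _ _ qH) -mulrA [_ * q ^+ H]mulrC.
(* the recursion is F(c + 1) = C * q ^ (2 ^ c) * F(c) ^ 2 with F(0) = B, and [p]
   is the square root of [q] *)
have windows c : (c <= b)%N -> forall a, (a + 2 ^ c <= H)%N ->
    sv 1 (M (t + a)%N (t + a + 2 ^ c)%N) <= (B * C * p ^+ c) ^+ (2 ^ c) / C.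
  elim: c => [|c IH] cb a aH.
    rewrite expn0 addn1 expr0 mulr1 expr1 mulfK ?lt0r_neq0 //.
    by case: chainM => _ _ letter _ _; apply: letter; move: aH; rewrite expn0; clear -tHN; lia.
  have two : (2 ^ c.+1 = 2 ^ c + 2 ^ c)%N by rewrite expnS mul2n addnn.
  rewrite two in aH *.
  have aH1 : (a + 2 ^ c <= H)%N by clear -aH; lia.
  have aH2 : (a + 2 ^ c + 2 ^ c <= H)%N by clear -aH; lia.
  have h1 := IH (ltnW cb) a aH1; have h2 := IH (ltnW cb) (a + 2 ^ c)%N aH2.
  move: (2 ^ c)%N => l in aH aH1 aH2 two h1 h2 *.
  have [ue ueP] := chain_directions chainM.
  have ij : (t + a <= t + a + l <= t + a + (l + l))%N by clear; lia.
  have jN : (t + a + (l + l) <= N)%N by clear -aH tHN; lia.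
  apply: le_trans (chain_window_defect B1 G0 q0 q1 chainM ueP ij jN) _.
  have -> : (t + a + l - (t + a) = l)%N by clear; lia.
  have -> : (t + a + (l + l) - (t + a + l) = l)%N by clear; lia.
  have := whole (a + l)%N aH1; rewrite !addnA => wh.
  rewrite !addnA in h2 *.
  have qHl : q ^+ H <= q ^+ l.
    by apply: ler_wiXn2l; rewrite ?(ltW q0) ?(ltW q1) // (leq_trans (leq_addl a l)).
  have ql0 : 0 < q ^+ l by rewrite exprn_gt0.
  have fac : sv 1 (M 0%N N) / (sv 1 (M 0%N (t + a + l)%N) * sv 1 (M (t + a + l)%N N)) +
     drift_const B G q * (q ^+ l + q ^+ l) <= C * q ^+ l.
    apply: le_trans (lerD wh (lexx _)) _; rewrite -/K /C.
    have -> : (2 + 2 * K) * q ^+ l = (q ^+ l + q ^+ l) + K * (q ^+ l + q ^+ l) by ring.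
    by rewrite lerD2r; apply: le_trans qHl _; rewrite lerDl ltW.
  have -> : (B * C * p ^+ c.+1) ^+ (l + l) / C =
     ((B * C * p ^+ c) ^+ l / C) * ((B * C * p ^+ c) ^+ l / C) * (C * q ^+ l).
    have pq : p ^+ (l + l) = q ^+ l by rewrite /q -exprM mul2n addnn.
    rewrite exprSr mulrA exprMn pq exprD.
    by move: (_ ^+ l) (q ^+ l) => x y; field; rewrite lt0r_neq0.
  apply: ler_pM.
  - exact: mulr_ge0 (singular1_ge0 _) (singular1_ge0 _).
  - have X0 := mulr_ge0 (singular1_ge0 (M 0%N (t + a + l)%N))
                        (singular1_ge0 (M (t + a + l)%N N)).
    apply: addr_ge0 (divr_ge0 (singular1_ge0 _) X0) (mulr_ge0 K0 _).
    by apply: ltW; apply: addr_gt0.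
  - exact: ler_pM (singular1_ge0 _) (singular1_ge0 _) h1 h2.
  - exact: fac.
have := windows b (leqnn b) 0%N; rewrite add0n -HE addn0 => /(_ (leqnn _)) small.
have one : 1 <= sv 1 (M t (t + H)%N).
  by case: chainM => _ h _ _ _; apply: (h _ _ _).1; rewrite leq_addr.
have := le_trans one small; rewrite ler_pdivlMr // mul1r leNgt => /negP; apply.
apply: le_lt_trans C1; apply: exprn_ile1 bP.
exact: mulr_ge0 (mulr_ge0 (ltW B0) (ltW C0)) (exprn_ge0 _ (ltW p0)).
Qed.
End DominatedChain.

(** * Geodesic words *)

Opaque spectral_radius.

Section Words.
Variables (Gamma : groupType) (S : seq Gamma).
Hypothesis genS : generates S.

Definition letters (w : seq Gamma) := {in w, forall s, s \in S \/ (s^-1)%g \in S}.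

Definition geodesic (w : seq Gamma) :=
  letters w /\ size w = word_length S (\prod_(s <- w) s)%g.

Lemma word_lengthP g : is_word S g (word_length S g) /\
  forall k, is_word S g k -> (word_length S g <= k)%N.
Proof.
rewrite /word_length; case: xgetP => [n _ []//|no].
exfalso; have ex : exists n, `[< is_word S g n >].
  by have [n gn] := genS g; exists n; apply/asboolP.
case: (ex_minnP ex) => n /asboolP gn minn; apply: (no n); split => // j gj.
by apply: minn; apply/asboolP.
Qed.

Lemma geodesic_exists g : exists2 w, geodesic w & g = (\prod_(s <- w) s)%g.
Proof.
have [[w [szw wS gE]] _] := word_lengthP g.
by exists w; rewrite // /geodesic -gE szw.
Qed.

Lemma letters_cat w1 w2 : letters (w1 ++ w2) <-> letters w1 /\ letters w2.
Proof.
split=> [l|[l1 l2] s]; last by rewrite mem_cat => /orP[/l1|/l2].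
by split=> s sw; apply: l; rewrite mem_cat sw ?orbT.
Qed.

Lemma word_length_le w : letters w -> (word_length S (\prod_(s <- w) s)%g <= size w)%N.
Proof. by move=> lw; apply: (word_lengthP _).2; exists w. Qed.

(** A shorter word for one of the two factors would shorten the whole word. *)
Lemma geodesic_cat w1 w2 : geodesic (w1 ++ w2) -> geodesic w1 /\ geodesic w2.
Proof.
move=> [/letters_cat[l1 l2]]; rewrite size_cat big_cat /= => szE.
have [v1 [l1' sz1] v1E] := geodesic_exists (\prod_(s <- w1) s)%g.
have [v2 [l2' sz2] v2E] := geodesic_exists (\prod_(s <- w2) s)%g.
have le1 := word_length_le l1; have le2 := word_length_le l2.
have : (word_length S ((\prod_(s <- w1) s) * (\prod_(s <- w2) s))%g <=
        size v1 + size v2)%N.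
  by rewrite v1E v2E -big_cat -size_cat; apply: word_length_le; apply/letters_cat.
rewrite -szE sz1 sz2 -v1E -v2E => le.
by split; split => //; clear -le le1 le2; lia.
Qed.

Lemma geodesic_drop_take w i j : geodesic w -> geodesic (drop i (take j w)).
Proof.
move=> gw; have [g1 _] : geodesic (take j w) /\ geodesic (drop j w).
  by apply: geodesic_cat; rewrite cat_take_drop.
have [] // : geodesic (take i (take j w)) /\ geodesic (drop i (take j w)).
by apply: geodesic_cat; rewrite cat_take_drop.
Qed.
End Words.

(** * Matrix lifts of a projective representation *)

Section Lifts.
Variables (R : realType) (Gamma : groupType) (n : nat).
Local Notation m := n.+1.
Variable rho : representation R Gamma m.
Implicit Types g h : Gamma.

(** A matrix that represents [rho g]; it is multiplicative up to sign only, which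
    norms, singular values and the moduli of traces and eigenvalues ignore. *)
Definition mxlift g : 'M[R]_m := (repr (rho g) : SL R m).

Lemma lift_det g : \det (mxlift g) = 1.
Proof. exact: detSL. Qed.

Lemma liftM g h : mxlift (g * h)%g = mxlift g *m mxlift h \/
  mxlift (g * h)%g = - (mxlift g *m mxlift h).
Proof.
rewrite /mxlift gmulfM.
exact: (PSL_reprP (SL_mul (repr (rho g)) (repr (rho h)))).
Qed.

Lemma lift1 : mxlift 1%g = 1 \/ mxlift 1%g = -1.
Proof. by rewrite /mxlift gmulf1; apply: (PSL_reprP (SL_one R m)). Qed.

Lemma lift_prod (w : seq Gamma) : exists b : bool,
  \prod_(s <- w) mxlift s = (-1) ^+ b *: mxlift (\prod_(s <- w) s)%g.
Proof.
elim: w => [|s w [b IH]].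
  rewrite !big_nil; case: lift1 => ->; [exists false|exists true].
    by rewrite expr0 scale1r.
  by rewrite expr1 scaleN1r opprK.
rewrite !big_cons IH; case: (liftM s (\prod_(t <- w) t)%g) => ->; [exists b|exists (~~ b)].
  by rewrite -scalerAr.
by rewrite -scalerAr signrN scaleNr scalerN opprK.
Qed.

End Lifts.

Section SigmaBasics.
Variables (R : realType) (Gamma : groupType) (n : nat).
Variable tau : representation R Gamma n.+2.
Implicit Types g h : Gamma.

Lemma sigma_lift i g : sigma i (tau g) = singular_value i (mxlift tau g).
Proof. by []. Qed.

Lemma sigma_prod i (w : seq Gamma) :
  singular_value i (\prod_(s <- w) mxlift tau s) = sigma i (tau (\prod_(s <- w) s)%g).
Proof.
have [[] ->] := lift_prod tau w; last by rewrite expr0 scale1r.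
by rewrite expr1 scaleN1r singular_valueN.
Qed.

Lemma sigma1_mul g h : sigma 1 (tau (g * h)%g) <= sigma 1 (tau g) * sigma 1 (tau h).
Proof.
rewrite !sigma_lift; have := singular1_mul (mxlift tau g) (mxlift tau h).
by case: (liftM tau g h) => ->; rewrite ?singular_valueN.
Qed.

(** The product of the singular values is 1, and the first one is the largest. *)
Lemma sigma_det g : 1 <= sigma 1 (tau g) ^+ n.+1 * sigma 2 (tau g).
Proof.
by have [_ _ _ + _] := top_singular (mxlift tau g); rewrite lift_det normr1.
Qed.

Lemma sigma1_ge1 g : 1 <= sigma 1 (tau g).
Proof.
have [_ s21 _ _ _] := top_singular (mxlift tau g).
have s10 := singular1_ge0 (mxlift tau g).
rewrite -(@ler_pXn2r _ n.+2) ?nnegrE // expr1n; apply: le_trans (sigma_det g) _.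
by rewrite [leRHS]exprSr ler_wpM2l // exprn_ge0.
Qed.

Lemma sigma2_gt0 g : 0 < sigma 2 (tau g).
Proof.
have := lt_le_trans ltr01 (sigma_det g).
by rewrite pmulr_rgt0 // exprn_gt0 // (lt_le_trans ltr01) ?sigma1_ge1.
Qed.

Lemma sigma1_gt0 g : 0 < sigma 1 (tau g).
Proof. exact: lt_le_trans ltr01 (sigma1_ge1 g). Qed.

Lemma sigma1_one : sigma 1 (tau 1%g) <= 1.
Proof.
rewrite sigma_lift; apply: singular1_le => v.
by case: (lift1 tau) => ->; rewrite ?mulNmx ?enormN -[1]/(1%:M) mul1mx mul1r.
Qed.

Definition log_norm g : R := ln (sigma 1 (tau g)).

Lemma log_normE g : log_norm g = ln (sigma 1 (tau g)).
Proof. by []. Qed.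

Lemma log_norm_ge0 g : 0 <= log_norm g.
Proof. by rewrite ln_ge0 ?sigma1_ge1. Qed.

Lemma log_norm_mul g h : log_norm (g * h)%g <= log_norm g + log_norm h.
Proof.
rewrite /log_norm -lnM ?posrE ?sigma1_gt0 // ler_ln ?posrE ?mulr_gt0 ?sigma1_gt0 //.
exact: sigma1_mul.
Qed.

Lemma log_norm1 : log_norm 1%g = 0.
Proof.
apply/le_anti; rewrite log_norm_ge0 andbT -ln1 ler_ln ?posrE ?sigma1_gt0 //.
exact: sigma1_one.
Qed.

Lemma log_norm_prod (w : seq Gamma) r : (forall h, h \in w -> log_norm h <= r) ->
  log_norm (\prod_(h <- w) h)%g <= r *+ size w.
Proof.
elim: w => [|h w IH] wr; first by rewrite big_nil log_norm1 mulr0n.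
rewrite big_cons mulrS; apply: le_trans (log_norm_mul _ _) _; apply: lerD.
  by apply: wr; rewrite mem_head.
by apply: IH => t tw; apply: wr; rewrite inE tw orbT.
Qed.
End SigmaBasics.

Opaque sigma.

(** * Operator norms along geodesics of an Anosov representation *)

Lemma ln_quasi_multiplicative (R : realType) (a b c Q : R) :
  0 < a -> 0 < b -> 0 < c -> 0 < Q -> a * b <= Q * c -> ln a + ln b <= ln c + `|ln Q|.
Proof.
move=> a0 b0 c0 Q0; rewrite -ler_ln ?posrE ?mulr_gt0 // !lnM ?posrE // => le.
by apply: le_trans le _; rewrite addrC lerD2l ler_norm.
Qed.

Lemma piece_arith (R : realType) (r kappa lB x y : R) : r - lB < x ->
  y + (r - (kappa + lB + 2)) + kappa <= x + y.
Proof. lra. Qed.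

Section Anosov.
Variables (R : realType) (Gamma : groupType) (n : nat).
Variable tau : representation R Gamma n.+2.
Variable S : seq Gamma.
Hypotheses (genS : generates S) (tauA : projective_anosov tau).
Local Notation f := (log_norm tau).

Let lettersB : exists2 B, 1 <= B & forall s, s \in S \/ (s^-1)%g \in S ->
  sigma 1 (tau s) <= B /\ sigma 1 (tau (s^-1)%g) <= B.
Proof.
pose B := 1 + \sum_(s <- S) (sigma 1 (tau s) + sigma 1 (tau (s^-1)%g)).
have pos s : 0 <= sigma 1 (tau s) by rewrite ltW ?sigma1_gt0.
exists B; first by rewrite lerDl sumr_ge0 // => s _; rewrite addr_ge0.
have inS s : s \in S -> sigma 1 (tau s) + sigma 1 (tau (s^-1)%g) <= B.
  move=> sS; rewrite /B (big_rem s) //= addrCA lerDl addr_ge0 //.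
  by rewrite sumr_ge0 // => t _; rewrite addr_ge0.
move: (B) inS => {}B inS s [/inS le|/inS le].
  split; apply: le_trans le.
    by rewrite lerDl pos.
  by rewrite lerDr pos.
rewrite invgK in le; split; apply: le_trans le.
  by rewrite lerDr pos.
by rewrite lerDl pos.
Qed.

(** The second singular value is at least a negative power of the first one, so
    that a large ratio of the two makes the first one large. *)
Lemma anosov_log_norm_proper r : exists b : nat, forall h, f h <= r ->
  (word_length S h <= b)%N.
Proof.
have [_ /(_ S genS)[C [mu [C0 mu0 gap]]]] := tauA.
have [b bP] : exists b : nat, (n.+2%:R * r - ln C) / mu <= b%:R.
  by exists (Num.Def.trunc ((n.+2%:R * r - ln C) / mu)).+1; apply/ltW/truncnS_gt.
exists b => h hr; rewrite -(ler_nat R); apply: le_trans bP.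
rewrite ler_pdivlMr // lerBrDr mulrC.
have s1 := sigma1_gt0 tau h; have s2 := sigma2_gt0 tau h.
have le : C * expR (mu * (word_length S h)%:R) <= sigma 1 (tau h) ^+ n.+2.
  apply: le_trans (gap h) _; rewrite ler_pdivrMr // exprS -mulrA ler_pMr //.
  exact: sigma_det.
have := le; rewrite -ler_ln ?posrE;
  [|by rewrite mulr_gt0 ?expR_gt0|by rewrite exprn_gt0].
rewrite lnM ?posrE ?expR_gt0 // expRK lnXn // addrC => /le_trans; apply.
rewrite -[leLHS]mulr_natl; exact: ler_wpM2l.
Qed.

(** Products of consecutive letters of a geodesic word form a dominated chain. *)
Lemma anosov_quasi_additive : exists2 kappa, 0 <= kappa & forall w1 w2,
  geodesic S (w1 ++ w2) ->
  f (\prod_(s <- w1) s)%g + f (\prod_(s <- w2) s)%g <=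
  f (\prod_(s <- w1 ++ w2) s)%g + kappa.
Proof.
have [_ /(_ S genS)[C [mu [C0 mu0 gap]]]] := tauA.
have [B B1 letB] := lettersB.
pose p := expR (- (mu / 2)).
have p01 : 0 < p < 1.
  by rewrite expR_gt0 -expR0 ltr_expR oppr_lt0 divr_gt0.
have [Q Q0 quasi] := @dominated_chain_quasi_multiplicative R n B C^-1 p B1
   (ltW (etrans (invr_gt0 C) C0)) p01.
exists `|ln Q| => // w1 w2 geo.
pose w := w1 ++ w2; pose N := size w.
pose sub i j := drop i (take j w).
pose M i j := \prod_(s <- sub i j) mxlift tau s.
have svM a i j : singular_value a (M i j) = sigma a (tau (\prod_(s <- sub i j) s)%g).
  exact: sigma_prod.
have subD i l j : (i <= l <= j)%N -> (j <= N)%N -> sub i j = sub i l ++ sub l j.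
  move=> /andP[il lj] jN; rewrite /sub.
  rewrite -[in LHS](cat_take_drop l (take j w)) take_takel //.
  rewrite drop_cat size_takel ?(leq_trans lj) //.
  case: ltnP => // li; have -> : l = i by apply/eqP; rewrite eqn_leq li il.
  by rewrite subnn drop0 [drop i (take i w)]drop_oversize // size_take_min geq_minl.
have sizesub i j : (i <= j <= N)%N -> size (sub i j) = (j - i)%N.
  by move=> /andP[ij jN]; rewrite size_drop size_takel.
have wl i j : (i <= j <= N)%N -> word_length S (\prod_(s <- sub i j) s)%g = (j - i)%N.
  by move=> ij; rewrite -(sizesub _ _ ij); have [_ <-] := geodesic_drop_take genS i j geo.
have sub1 i : (i < N)%N -> sub i i.+1 = [:: nth 1%g w i].
  move=> iN; rewrite /sub (take_nth 1%g) // -cats1 drop_cat size_takel ?(ltnW iN) //.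
  by rewrite ltnn subnn.
have letter i : (i < N)%N -> nth 1%g w i \in S \/ ((nth 1%g w i)^-1)%g \in S.
  by move=> iN; case: geo => lw _; apply: lw; rewrite mem_nth.
have chain : dominated_chain B C^-1 (p ^+ 2) N M.
  split.
  - split=> [i|i l j il jN]; last by rewrite /M (subD i l j) // big_cat.
    by rewrite /M /sub drop_oversize ?big_nil // size_take_min geq_minl.
  - move=> i j ij; rewrite !svM; split; first exact: sigma1_ge1.
    set g := (\prod_(s <- _) s)%g; have := gap g.
    rewrite wl // ler_pdivlMr ?sigma2_gt0 // => le.
    have -> : (p ^+ 2) ^+ (j - i) = (expR (mu * (j - i)%:R))^-1.
      by rewrite -exprM /p -expRM_natr -expRN natrM; congr expR; field.
    by rewrite -invfM mulrC ler_pdivlMr ?mulr_gt0 ?expR_gt0 // mulrC.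
  - move=> i iN; rewrite svM sub1 // big_seq1.
    by have [] := letB _ (letter i iN).
  - move=> i j /andP[ij jN]; rewrite !svM (subD i i.+1 j) ?leqnSn // sub1 ?(leq_trans ij) //.
    rewrite big_cat big_seq1 /=; set h := (\prod_(s <- _) s)%g.
    set s := nth _ _ _; have {1}-> : h = (s^-1 * (s * h))%g by rewrite mulKg.
    apply: le_trans (sigma1_mul _ _ _) _; apply: ler_wpM2r; first by rewrite ltW ?sigma1_gt0.
    by have [] := letB _ (letter i (leq_trans ij jN)).
  - move=> i j /andP[ij jN]; rewrite !svM (subD i j j.+1) ?ij ?leqnSn // sub1 //.
    rewrite big_cat big_seq1 /=; set h := (\prod_(s <- _) s)%g.
    set s := nth _ _ _; have {1}-> : h = (h * s * s^-1)%g by rewrite mulgK.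
    apply: le_trans (sigma1_mul _ _ _) _; rewrite mulrC; apply: ler_wpM2r.
      by rewrite ltW ?sigma1_gt0.
    by have [] := letB _ (letter j jN).
have w1N : (size w1 <= N)%N by rewrite /N size_cat leq_addr.
have := quasi N M chain _ w1N.
rewrite !svM /sub drop0 take_size_cat // drop0 /N take_size drop_size_cat //.
exact: ln_quasi_multiplicative (sigma1_gt0 _ _) (sigma1_gt0 _ _) (sigma1_gt0 _ _) Q0.
Qed.

Let letters_log_norm : exists2 lB, 0 <= lB &
  forall s, s \in S \/ (s^-1)%g \in S -> f s <= lB.
Proof.
have [B B1 letB] := lettersB; exists (ln B); first by rewrite ln_ge0.
move=> s /letB[sB _]; rewrite ler_ln ?posrE ?sigma1_gt0 //.
exact: lt_le_trans ltr01 B1.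
Qed.

Opaque log_norm.

(** A geodesic word is cut greedily into pieces whose norm is as large as the
    bound allows; the norms of the pieces multiply up to bounded factors. *)
Lemma anosov_pieces : exists2 beta, 1 < beta & forall r, beta < r -> forall g,
  exists2 hs : seq Gamma, (forall h, h \in hs -> f h <= r) /\ g = (\prod_(h <- hs) h)%g
   & (size hs)%:R * (r - beta) <= f g + (r - beta).
Proof.
have [kappa kappa0 quasi] := anosov_quasi_additive.
have [lB lB0 letterB] := letters_log_norm.
exists (kappa + lB + 2) => [|r betar]; first by lra.
suff cut N : forall w, (size w <= N)%N -> geodesic S w -> exists2 hs : seq Gamma,
    (forall h, h \in hs -> f h <= r) /\ (\prod_(s <- w) s)%g = (\prod_(h <- hs) h)%g
   & (size hs)%:R * (r - (kappa + lB + 2)) <=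
     f (\prod_(s <- w) s)%g + (r - (kappa + lB + 2)).
  move=> g; have [w gw ->] := geodesic_exists genS g.
  exact: cut (leqnn (size w)) gw.
elim: N => [|N IH] w szw gw.
  exists [::]; first last.
    by rewrite mul0r addr_ge0 ?log_norm_ge0 // subr_ge0 ltW.
  by split=> //; move: szw; rewrite leqn0 => /nilP->; rewrite !big_nil.
have [small|big] : f (\prod_(s <- w) s)%g <= r \/ r < f (\prod_(s <- w) s)%g.
  by apply/orP; rewrite leNgt orNb.
  exists [:: (\prod_(s <- w) s)%g]; last first.
    rewrite [size _]/= mul1r lerDr; exact: log_norm_ge0.
  split; last by rewrite big_seq1.
  by move=> h; rewrite inE => /eqP->.
(* the last letter of the shortest prefix with norm above [r - lB] adds at most
   [lB], so that the norm of this prefix is still at most [r] *)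
have ex : exists i, r - lB < f (\prod_(s <- take i w) s)%g.
  by exists (size w); rewrite take_size (le_lt_trans _ big) // gerBl.
case: (ex_minnP ex) => i ilarge imin.
have i0 : (0 < i)%N.
  rewrite lt0n; apply/eqP => i0; move: ilarge; rewrite i0 take0 big_nil log_norm1.
  by lra.
have isz : (i <= size w)%N by apply: imin; rewrite take_size (le_lt_trans _ big) // gerBl.
have le_r : f (\prod_(s <- take i w) s)%g <= r.
  case: i i0 isz imin {ilarge} => // i _ isz imin.
  rewrite (take_nth 1%g) // -cats1 big_cat big_seq1 /=.
  apply: le_trans (log_norm_mul _ _ _) _.
  have : f (\prod_(s <- take i w) s)%g <= r - lB.
    by rewrite leNgt; apply/negP => /imin; rewrite ltnn.
  have := letterB (nth 1%g w i).
  have [lw _] := gw; move=> /(_ (lw _ (mem_nth _ isz))).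
  move: (f _) (f _) => x y yB xr; rewrite -[r](subrK (lB)); exact: lerD.
have geo : geodesic S (take i w ++ drop i w) by rewrite cat_take_drop.
have := quasi _ _ geo; rewrite cat_take_drop => qa.
have [_ gd] := geodesic_cat genS geo.
have szd : (size (drop i w) <= N)%N by rewrite size_drop; clear -i0 szw isz; lia.
have [hs [hsr hsE] szhs] := IH _ szd gd.
exists ((\prod_(s <- take i w) s)%g :: hs).
  split; last by rewrite big_cons -hsE -big_cat cat_take_drop.
  by move=> h; rewrite inE => /predU1P[->//|/hsr].
rewrite /= -natr1 mulrDl mul1r lerD2r; apply: le_trans szhs _.
rewrite -(lerD2r kappa); apply: le_trans qa.
exact: piece_arith.
Qed.
End Anosov.

(** * Growth of products and eigenvalues *)

Lemma le_slope (R : realType) (x y c : R) :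
  (forall N : nat, N%:R * x <= c + N%:R * y) -> x <= y.
Proof.
move=> h; rewrite leNgt; apply/negP => yx.
have xy : 0 < x - y by rewrite subr_gt0.
pose N := (Num.Def.trunc (c / (x - y))).+1.
have cN : c / (x - y) < N%:R by apply: truncnS_gt.
move: (h N); rewrite leNgt => /negP; apply.
by rewrite -ltrBrDr -mulrBr -ltr_pdivrMr.
Qed.

Section NormComparisons.
Variables (R : realType) (n : nat).
Implicit Types A : 'M[R]_n.+1.

Lemma coord_le_enorm k (v : 'cV[R]_k) i : `|v i 0| <= enorm v.
Proof.
rewrite -(@ler_pXn2r _ 2) ?nnegrE ?enorm_ge0 // enorm_sqr real_normK ?num_real //.
rewrite /dot (bigD1 i) //= -expr2 lerDl sumr_ge0 // => j _; rewrite -expr2; exact: sqr_ge0.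
Qed.

Lemma enorm_le_l1 k (v : 'cV[R]_k) : enorm v <= l1 v.
Proof.
rewrite -(@ler_pXn2r _ 2) ?nnegrE ?enorm_ge0 ?l1_ge0 // enorm_sqr expr2.
rewrite {1}/l1 mulr_suml; apply: ler_sum => i _; rewrite big_ord1.
apply: le_trans (ler_norm _) _; rewrite normrM; apply: ler_wpM2l => //.
exact: l1_entry.
Qed.

Lemma enorm_mulmx_l1 A v : enorm (A *m v) <= l1 A * enorm v.
Proof.
apply: le_trans (enorm_le_l1 _) _; rewrite /l1 mulr_suml; apply: ler_sum => i _.
rewrite big_ord1 mxE; apply: le_trans (ler_norm_sum _ _ _) _.
rewrite mulr_suml; apply: ler_sum => j _; rewrite normrM.
by apply: ler_wpM2l => //; apply: coord_le_enorm.
Qed.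

Lemma spectral_radius_ge1 A : \det A = 1 -> 1 <= spectral_radius A.
Proof.
move=> detA; have [xs [szxs cpE _]] := char_poly_power_sums (complex_mx A).
have r0 := spectral_radius_ge0 A.
have prod1 : \prod_(x <- xs) `|x| = 1.
  have := char_poly_det (complex_mx A); rewrite cpE coef0_prod_XsubC szxs.
  rewrite det_map_mx detA rmorph1 mulr1 => /(congr1 Num.norm).
  by rewrite normrM normrX normrN1 expr1n mul1r normr_prod.
have : \prod_(x <- xs) `|x| <= ((spectral_radius A ^+ size xs)%:C)%C.
  have le x : x \in xs -> `|x| <= ((spectral_radius A)%:C)%C.
    move=> xin; suff : ComplexField.Normc.normc x <= spectral_radius A.
      by rewrite -lecR -norm_normc.
    by apply: eigenvalue_moduli_normc; rewrite eigenvalue_root_char cpE root_prod_XsubC.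
  elim: (xs) le => [|x ys IH] le; first by rewrite big_nil expr0.
  rewrite big_cons /= exprS rmorphM; apply: ler_pM => //.
  - by apply: prodr_ge0.
  - by apply: le; rewrite mem_head.
  - by apply: IH => y yin; apply: le; rewrite inE yin orbT.
rewrite prod1 -(rmorph1 (real_complex R)) lecR szxs => le.
by rewrite -(@ler_pXn2r _ n.+1) ?nnegrE // expr1n.
Qed.

(** This replaces Gelfand's formula: the factor that does not depend on [p]
    disappears in the limit of large [p]. *)
Lemma powers_grow A p : (0 < n)%N -> 0 < spectral_radius A ->
  exists2 K, 0 < K & forall N,
    l1 (A ^+ (p * N)) <= K * (256 * n.+1%:R ^+ 5 * spectral_radius A ^+ p) ^+ N.
Proof.
move=> n0 r0; pose S : set 'M[R]_n.+1 := fun B => B = A ^+ p.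
have wE w : word_in S w -> \prod_(s <- w) s = A ^+ (p * size w).
  elim: w => [|s w IH] wS; first by rewrite big_nil muln0 expr0.
  have wS' : word_in S w by move=> t tw; apply: wS; rewrite inE tw orbT.
  by rewrite big_cons IH // (wS s) ?mem_head // mulnS exprD.
have [||| K KP] := @words_grow_of_traces R n S (l1 (A ^+ p)) (spectral_radius A ^+ p) n0.
- by move=> s ->.
- exact: exprn_gt0.
- move=> w wS _; rewrite wE // -exprM; exact: trace_power_spectral_radius.
exists (`|K| + 1) => [|N]; first by rewrite ltr_wpDl.
have wS : word_in S (nseq N (A ^+ p)) by move=> s; rewrite mem_nseq => /andP[_ /eqP].
have := KP _ wS; rewrite wE // size_nseq => /le_trans; apply.
apply: ler_wpM2r; last by have := ler_norm K; lra.
apply: exprn_ge0; apply: mulr_ge0; last by apply: exprn_ge0; apply: ltW.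
by apply: mulr_ge0 => //; apply: exprn_ge0.
Qed.
End NormComparisons.

Section Lifts.
Variables (R : realType) (Gamma : groupType) (n : nat).
Variable rho : representation R Gamma n.+1.
Implicit Types g h : Gamma.

Lemma liftX g k : exists b : bool, mxlift rho (g ^+ k)%g = (-1) ^+ b *: mxlift rho g ^+ k.
Proof.
elim: k => [|k [b IH]].
  rewrite expg0 expr0; case: (lift1 rho) => ->; [exists false|exists true].
    by rewrite expr0 scale1r.
  by rewrite expr1 scaleN1r.
rewrite expgS; case: (liftM rho g (g ^+ k)%g) => ->; [exists b|exists (~~ b)].
  by rewrite IH -scalemxAr exprS.
by rewrite IH -scalemxAr exprS signrN scaleNr.
Qed.

Lemma l1_sign k (b : bool) (A : 'M[R]_k) : l1 ((-1) ^+ b *: A) = l1 A.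
Proof. by rewrite l1Z normrX normrN1 expr1n mul1r. Qed.

Lemma lambda1_lift g : lambda1 (rho g) = spectral_radius (mxlift rho g).
Proof. by []. Qed.

Lemma lambda1_ge1 g : 1 <= lambda1 (rho g).
Proof. by rewrite lambda1_lift spectral_radius_ge1 // lift_det. Qed.

Lemma lambda1_gt0 g : 0 < lambda1 (rho g).
Proof. exact: lt_le_trans ltr01 (lambda1_ge1 g). Qed.

Lemma lambda1_power g k : lambda1 (rho g) ^+ k <= l1 (mxlift rho (g ^+ k)%g).
Proof.
by have [b ->] := liftX g k; rewrite l1_sign lambda1_lift spectral_radius_expr.
Qed.

Lemma trace_lambda1 g (b : bool) :
  `|\tr ((-1) ^+ b *: mxlift rho g)| <= n.+1%:R * lambda1 (rho g).
Proof.
rewrite linearZ /= normrM normrX normrN1 expr1n mul1r.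
by have := trace_power_spectral_radius (mxlift rho g) 1; rewrite !expr1.
Qed.
End Lifts.

(** Entries are bounded by the first singular value, so that the powers of both
    sides compare up to a constant that does not depend on the exponent. *)
Lemma lambda1_le_sigma1 (R : realType) (Gamma : groupType) (n : nat)
  (tau : representation R Gamma n.+2) g : ln (lambda1 (tau g)) <= log_norm tau g.
Proof.
have l1_le (A : 'M[R]_n.+2) : l1 A <= (n.+2 * n.+2)%:R * singular_value 1 A.
  have entry i j : `|A i j| <= singular_value 1 A.
    have dE : dot (delta_mx j 0 : 'cV[R]_n.+2) (delta_mx j 0) = 1.
      rewrite /dot (bigD1 j) //= big1 => [|l lj]; rewrite !mxE ?eqxx ?mulr1 ?addr0 //.
      by rewrite (negPf lj) mul0r.
    have := enorm_singular1 A (delta_mx j 0); rewrite {2}/enorm dE sqrtr1 mulr1.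
    apply: le_trans; apply: le_trans (coord_le_enorm (A *m delta_mx j 0) i).
    by rewrite -colE mxE.
  rewrite /l1; have -> : (n.+2 * n.+2)%:R * singular_value 1 A =
     \sum_(i < n.+2) \sum_(j < n.+2) singular_value 1 A.
    by rewrite !sumr_const !card_ord -mulrnA mulr_natl.
  by apply: ler_sum => i _; apply: ler_sum => j _.
pose K : R := (n.+2 * n.+2)%:R.
have K0 : 0 < K by rewrite ltr0n.
apply: (@le_slope _ _ _ (ln K)) => N.
have step : ln (lambda1 (tau g) ^+ N) <= ln (K * sigma 1 (tau g) ^+ N).
  have s0 := sigma1_gt0 tau g; have l0 := lambda1_gt0 tau g.
  rewrite ler_ln ?posrE ?mulr_gt0 ?exprn_gt0 //.
  apply: le_trans (lambda1_power tau g N) _; apply: le_trans (l1_le _) _.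
  apply: ler_wpM2l; first exact: ltW.
  elim: N => [|N IH]; first by rewrite expg0 expr0; apply: sigma1_one.
  rewrite expgS exprS; apply: le_trans (sigma1_mul tau g (g ^+ N)%g) _.
  by apply: ler_wpM2l => //; apply: ltW.
move: step; rewrite lnM ?posrE ?exprn_gt0 ?sigma1_gt0 // !lnXn ?sigma1_gt0 ?lambda1_gt0 //.
by rewrite !mulr_natl.
Qed.

Lemma ln_affine (R : realType) (K C l : R) p N : 0 < K -> 0 < C -> 0 < l ->
  ln (K * (C * l ^+ p) ^+ N) = ln K + N%:R * (ln C + p%:R * ln l).
Proof.
move=> K0 C0 l0; have lp : 0 < l ^+ p by apply: exprn_gt0.
have Cl : 0 < C * l ^+ p by apply: mulr_gt0.
have ClN : 0 < (C * l ^+ p) ^+ N by apply: exprn_gt0.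
by rewrite lnM // lnXn // lnM // lnXn // !mulr_natl.
Qed.

Lemma dilation_arith (R : realType) (x y d b fg s lK lK1 lC0 N p : R) :
  0 < d -> 0 <= b -> fg <= lK1 + N * (lC0 + p * y) -> p * N * x <= lK + s * b ->
  s * d <= fg + d ->
  N * (p * (d * x)) <= d * lK + b * (lK1 + d) + N * (b * lC0 + p * (b * y)).
Proof.
move=> d0 b0 h1 h2 h3.
have := ler_wpM2l (ltW d0) h2; have := ler_wpM2l b0 (le_trans h3 (lerD h1 (lexx d))).
lra.
Qed.

Section Comparison.
Variables (R : realType) (Gamma : groupType) (n k : nat).
Variables (rho : representation R Gamma n.+1) (tau : representation R Gamma k.+2).
Local Notation f := (log_norm tau).

Definition small_lifts (r : R) : set 'M[R]_n.+1 :=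
  fun A => exists2 h, f h <= r & A = mxlift rho h.

(** A power of [g] is a product of elements of the [r]-ball, in a number which
    is about its logarithmic norm divided by [r - beta]; it suffices to bound
    the growth of the image under [rho] of such products. *)
Lemma dilation_of_growth (r beta b : R) : beta < r -> 0 <= b ->
  (forall g, exists2 hs : seq Gamma,
     (forall h, h \in hs -> f h <= r) /\ g = (\prod_(h <- hs) h)%g
     & (size hs)%:R * (r - beta) <= f g + (r - beta)) ->
  words_grow (small_lifts r) (expR b) ->
  forall g, (r - beta) * ln (lambda1 (rho g)) <= b * ln (lambda1 (tau g)).
Proof.
move=> rbeta b0 pieces [K2 K2P] g.
set x := ln (lambda1 (rho g)); set y := ln (lambda1 (tau g)).
have rb : 0 < r - beta by rewrite subr_gt0.
pose C0 : R := 256 * k.+2%:R ^+ 5.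
have C1 : 1 <= C0.
  rewrite /C0; have : 1 <= k.+2%:R ^+ 5 :> R by rewrite exprn_ege1 // ler1n.
  by lra.
have C0p : 0 < C0 by apply: lt_le_trans C1.
have lt0 := lambda1_gt0 tau g.
(* first the number [N] of blocks of length [p] tends to infinity, which absorbs
   the constants of both growth estimates, then [p], which absorbs [C0] *)
apply: (@le_slope _ _ _ (b * ln C0)) => p.
pose K := `|K2| + 1.
have Kp : 0 < K by rewrite ltr_wpDl.
have [K1 K10 K1P] := @powers_grow R k.+1 (mxlift tau g) p isT lt0.
have fle N : f (g ^+ (p * N))%g <= ln K1 + N%:R * (ln C0 + p%:R * y).
  have -> : ln K1 + N%:R * (ln C0 + p%:R * y) =
      ln (K1 * (C0 * lambda1 (tau g) ^+ p) ^+ N).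
    by rewrite ln_affine.
  have s0 := sigma1_gt0 tau (g ^+ (p * N))%g.
  rewrite log_normE ler_ln ?posrE ?mulr_gt0 ?exprn_gt0 ?mulr_gt0 ?exprn_gt0 //.
  apply: le_trans (K1P N); rewrite sigma_lift; apply: singular1_le => v.
  have [c ->] := liftX tau g (p * N).
  by apply: le_trans (enorm_mulmx_l1 _ v) _; rewrite l1_sign.
apply: (@le_slope _ _ _ ((r - beta) * ln K + b * (ln K1 + (r - beta)))) => N.
have [hs [hsr gE] szhs] := pieces (g ^+ (p * N))%g.
have xle : (p * N)%:R * x <= ln K + (size hs)%:R * b.
  have bound : lambda1 (rho g) ^+ (p * N) <= K * expR b ^+ size hs; last first.
    have e0 := expR_gt0 b; have rho0 := lambda1_gt0 rho g.
    have {}bound : ln (lambda1 (rho g) ^+ (p * N)) <= ln (K * expR b ^+ size hs).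
      rewrite ler_ln ?posrE //; first exact: exprn_gt0.
      by apply: mulr_gt0 => //; apply: exprn_gt0.
    move: bound; rewrite lnXn // mulr_natl lnM ?posrE //; last exact: exprn_gt0.
    by rewrite lnXn // expRK mulr_natl.
  apply: le_trans (lambda1_power rho g _) _; rewrite gE.
  have wS : word_in (small_lifts r) [seq mxlift rho h | h <- hs].
    by move=> _ /mapP[h hin ->]; exists h => //; apply: hsr.
  have := K2P _ wS; rewrite size_map big_map.
  have [c ->] := lift_prod rho hs; rewrite l1_sign => /le_trans; apply.
  by apply: ler_wpM2r; [rewrite exprn_ge0 ?expR_ge0|rewrite /K; have := ler_norm K2; lra].
move: (fle N) xle szhs; rewrite natrM.
move: (f _) (size hs)%:R (ln K) (ln K1) (ln C0) (N%:R : R) (p%:R : R) => fg s lK lK1 lC0 N' p'.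
by move=> h1 h2 h3; apply: dilation_arith h1 h2 h3.
Qed.
End Comparison.

(** * The bound for the dilation *)

Opaque lambda1.

Section Balls.
Variables (R : realType) (Gamma : groupType) (n k : nat).
Variables (rho : representation R Gamma n.+1) (tau : representation R Gamma k.+2).
Variable S : seq Gamma.
Hypotheses (genS : generates S) (tauA : projective_anosov tau).

(** By properness the [r]-ball consists of words of bounded length. *)
Lemma small_lifts_bounded r : exists b, forall A, small_lifts rho tau r A -> l1 A <= b.
Proof.
have [N NP] := anosov_log_norm_proper genS tauA r.
pose B := \sum_(s <- S) (l1 (mxlift rho s) + l1 (mxlift rho s^-1%g)).
have letB s : s \in S \/ (s^-1)%g \in S -> l1 (mxlift rho s) <= B.
  have inS t : t \in S -> l1 (mxlift rho t) + l1 (mxlift rho t^-1%g) <= B.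
    move=> tS; rewrite /B (big_rem t) //= lerDl.
    by apply: sumr_ge0 => u _; apply: addr_ge0; apply: l1_ge0.
  move=> [/inS|/inS]; rewrite ?invgK; apply: le_trans; rewrite ?lerDl ?lerDr; exact: l1_ge0.
pose T : set 'M[R]_n.+1 := fun A =>
  exists2 s, s \in S \/ (s^-1)%g \in S & A = mxlift rho s.
have [|K KP] := @words_grow_bounded R n T B; first by move=> A [s sS ->]; apply: letB.
exists (`|K| * (`|B| + 1) ^+ N) => _ [h /NP hN ->].
have [w [lw szw] hE] := geodesic_exists genS h.
have wS : word_in T [seq mxlift rho s | s <- w].
  by move=> _ /mapP[s sw ->]; exists s => //; apply: lw.
have := KP _ wS; rewrite big_map size_map.
have [c ->] := lift_prod rho w; rewrite l1_sign -hE => /le_trans; apply.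
apply: (@le_trans _ _ (`|K| * (`|B| + 1) ^+ size w)).
  by apply: ler_wpM2r; [rewrite exprn_ge0 // addr_ge0|exact: ler_norm].
apply: ler_wpM2l => //; apply: ler_weXn2l; first by rewrite lerDr.
by rewrite szw -hE.
Qed.
End Balls.

Lemma rescaled_bound (R : realType) (d r L beta c D x y : R) : 0 < d -> L = d * r ->
  (r - beta) * x <= (c + D * r) * y -> (L - d * beta) * x <= (c * d + D * L) * y.
Proof.
move=> d0 -> le; have -> : (d * r - d * beta) * x = d * ((r - beta) * x) by ring.
have -> : (c * d + D * (d * r)) * y = d * ((c + D * r) * y) by ring.
by rewrite ler_pM2l.
Qed.

Lemma ratio_bound (R : realType) (x y a b den : R) : 0 < den -> 0 < y ->
  den * x <= (a + b) * y -> x / y <= a / den + b / den.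
Proof.
by move=> den0 y0 le; rewrite -mulrDl ler_pdivrMr // mulrAC ler_pdivlMr // mulrC.
Qed.

Section DilationBound.
Variables (R : realType) (Gamma : groupType) (n k : nat).
Variables (rho : representation R Gamma n.+2) (tau : representation R Gamma k.+2).
Variables (S : seq Gamma) (beta : R).
Hypotheses (genS : generates S) (tauA : projective_anosov tau).
Hypothesis beta1 : 1 < beta.
Hypothesis pieces : forall r, beta < r -> forall g, exists2 hs : seq Gamma,
  (forall h, h \in hs -> log_norm tau h <= r) /\ g = (\prod_(h <- hs) h)%g
  & (size hs)%:R * (r - beta) <= log_norm tau g + (r - beta).

(** A crude bound for the growth suffices to see that [rho g] has no eigenvalue
    outside of the unit circle when [tau g] has none. *)
Lemma log_lambda_eq0 g : ln (lambda1 (tau g)) = 0 -> ln (lambda1 (rho g)) <= 0.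
Proof.
move=> tau0; have betaS : beta < beta + 1 by rewrite ltrDl.
have [B BP] := small_lifts_bounded rho genS tauA (beta + 1).
have grow := words_grow_bounded BP.
have B1 : 0 < `|B| + 1 by rewrite ltr_wpDl.
rewrite -[`|B| + 1]lnK ?posrE // in grow.
have b0 : 0 <= ln (`|B| + 1) by rewrite ln_ge0 // lerDr.
have := dilation_of_growth betaS b0 (pieces betaS) grow g.
by rewrite tau0 mulr0 addrAC subrr add0r mul1r.
Qed.

(** With [r = L / d], a product of [j <= d] elements of the [r]-ball has
    logarithmic norm at most [j * r <= L] under [tau], so that its eigenvalues
    under [rho] are at most [expR (D * r) ^+ j]: this is the hypothesis of the
    inequality on the growth of words. *)
Lemma log_lambda_bound (L D : R) : 0 <= D ->
  let d := (2 * n.+2 ^ 3)%N in d%:R * beta < L ->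
  (forall h, 0 < ln (lambda1 (tau h)) <= L ->
     ln (lambda1 (rho h)) <= D * ln (lambda1 (tau h))) ->
  forall g, (L - d%:R * beta) * ln (lambda1 (rho g)) <=
    (ln (256 * n.+2%:R ^+ 5) * d%:R + D * L) * ln (lambda1 (tau g)).
Proof.
move=> D0 d dL short g.
have d0 : 0 < d%:R :> R by rewrite ltr0n muln_gt0 expn_gt0.
pose r := L / d%:R.
have betar : beta < r by rewrite ltr_pdivlMr // mulrC.
have r0 : 0 < r by apply: lt_trans betar; apply: lt_trans beta1.
have tau_ge0 h : 0 <= ln (lambda1 (tau h)) by rewrite ln_ge0 ?lambda1_ge1.
have rho_le h : ln (lambda1 (tau h)) <= L ->
    ln (lambda1 (rho h)) <= D * ln (lambda1 (tau h)).
  move=> hL; have [h0|h0] := eqVneq (ln (lambda1 (tau h))) 0.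
    by rewrite h0 mulr0 log_lambda_eq0.
  by apply: short; rewrite hL andbT lt_def h0 tau_ge0.
set C : R := 256 * n.+2%:R ^+ 5.
have C1 : 1 <= C.
  have : 1 <= n.+2%:R ^+ 5 :> R by rewrite exprn_ege1 // ler1n.
  by rewrite /C; lra.
have C0 : 0 < C by apply: lt_le_trans C1.
have [B BP] := small_lifts_bounded rho genS tauA r.
have grow : words_grow (small_lifts rho tau r) (expR (ln C + D * r)).
  rewrite expRD lnK ?posrE //; apply: (words_grow_of_traces _ BP) => //.
    exact: expR_gt0.
  move=> w wS /andP[_ szw].
  have [hs hsr wE] : exists2 hs, forall h, h \in hs -> log_norm tau h <= r &
      w = [seq mxlift rho h | h <- hs].
    elim: w wS {szw} => [|A w IH] wS; first by exists [::].
    have [|hs hsr ->] := IH; first by move=> A' A'w; apply: wS; rewrite inE A'w orbT.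
    have [h hr ->] := wS A (mem_head _ _).
    exists (h :: hs); last by [].
    by move=> t; rewrite inE => /predU1P[->|/hsr].
  rewrite {}wE in szw *; rewrite size_map in szw *; rewrite big_map.
  have [c ->] := lift_prod rho hs; apply: le_trans (trace_lambda1 rho _ c) _.
  apply: ler_wpM2l => //; set h := (\prod_(h <- hs) h)%g.
  have lam0 := lambda1_gt0 rho h.
  rewrite -[leLHS]lnK ?posrE // -expRM_natl ler_expR.
  have norm_le := log_norm_prod hsr; rewrite -/h -mulr_natl in norm_le.
  have tauh : ln (lambda1 (tau h)) <= (size hs)%:R * r.
    exact: le_trans (lambda1_le_sigma1 tau h) norm_le.
  have size_le : (size hs)%:R * r <= L.
    have -> : L = d%:R * r by rewrite /r mulrC divfK // lt0r_neq0.
    by apply: ler_wpM2r; [exact: ltW|rewrite ler_nat].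
  apply: le_trans (rho_le h (le_trans tauh size_le)) _.
  by rewrite mulrCA; apply: ler_wpM2l.
have b0 : 0 <= ln C + D * r by apply: addr_ge0; [exact: ln_ge0|apply: mulr_ge0 => //; apply: ltW].
apply: (@rescaled_bound _ _ r) d0 _ (dilation_of_growth betar b0 (pieces betar) grow g).
by rewrite /r mulrC divfK // lt0r_neq0.
Qed.

Lemma Dil_bound (L : R) : let d := (2 * n.+2 ^ 3)%N in d%:R * beta < L ->
  (Dil rho tau <= (ln (256 * n.+2%:R ^+ 5) * d%:R / (L - d%:R * beta))%:E
     + Dil_upto rho tau L * (L / (L - d%:R * beta))%:E)%E.
Proof.
move=> d dL; set c := ln _.
have den : 0 < L - d%:R * beta by rewrite subr_gt0.
have L0 : 0 < L.
  by apply: le_lt_trans dL; apply: mulr_ge0 => //; apply: ltW; apply: lt_trans beta1.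
have c0 : 0 <= c.
  apply: ln_ge0; have : 1 <= n.+2%:R ^+ 5 :> R by rewrite exprn_ege1 // ler1n.
  by lra.
have q0 : 0 < L / (L - d%:R * beta) by apply: divr_gt0.
have c1 : 0 <= c * d%:R / (L - d%:R * beta).
  by apply: divr_ge0; [apply: mulr_ge0|apply: ltW].
have up0 : (0 <= Dil_upto rho tau L)%E by apply: ereal_sup_ubound; left.
case upE : (Dil_upto rho tau L) up0 => [D| |] // up0; last first.
  by rewrite gt0_mulye ?lte_fin // addey // leey.
rewrite lee_fin in up0; rewrite -EFinM -EFinD.
have short h : 0 < ln (lambda1 (tau h)) <= L ->
    ln (lambda1 (rho h)) <= D * ln (lambda1 (tau h)).
  move=> hL; have /andP[h0 _] := hL.
  have : ((log_ratio rho tau h)%:E <= Dil_upto rho tau L)%E.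
    by apply: ereal_sup_ubound; right; exists (log_ratio rho tau h) => //; exists h.
  by rewrite upE lee_fin /log_ratio ler_pdivrMr.
apply: ge_ereal_sup => _ [->|[_ [g _ <-] <-]]; rewrite lee_fin.
  by apply: addr_ge0 => //; apply: mulr_ge0 => //; apply: ltW.
have := log_lambda_bound up0 dL short g.
rewrite /log_ratio; have [->|t0] := eqVneq (ln (lambda1 (tau g))) 0.
  by rewrite invr0 => _; rewrite mulr0; apply: addr_ge0 => //; apply: mulr_ge0 => //; apply: ltW.
have tp : 0 < ln (lambda1 (tau g)) by rewrite lt_def t0 ln_ge0 ?lambda1_ge1.
by move=> le; rewrite mulrA; apply: ratio_bound.
Qed.
End DilationBound.

Theorem theorem1p8 (R : realType) :
  exists (c : nat -> R) (d : nat -> nat),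
    (forall m : nat, (1 <= m)%N ->
       [/\ 0 < c m, c m <= 8 * ln 2 + 5 * ln m%:R,
           (0 < d m)%N & (d m <= 2 * m ^ 3)%N]) /\
    (forall (Gamma : groupType), finitely_generated Gamma ->
     forall (k : nat) (tau : representation R Gamma k),
       projective_anosov tau ->
       exists beta : R, 1 < beta /\
         forall (m : nat) (rho : representation R Gamma m),
           (1 <= m)%N -> projective_anosov rho ->
           forall L : R, (d m)%:R * beta < L ->
             (Dil rho tau <=
                (c m * (d m)%:R / (L - (d m)%:R * beta))%:E
                + Dil_upto rho tau L * (L / (L - (d m)%:R * beta))%:E)%E).
Proof.
exists (fun m => ln (256 * m%:R ^+ 5)), (fun m => (2 * m ^ 3)%N); split.
  move=> m m0; have mp : 0 < m%:R :> R by rewrite ltr0n.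
  split=> //; last by rewrite muln_gt0 expn_gt0 m0.
    apply: ln_gt0; have : 1 <= m%:R ^+ 5 :> R by rewrite exprn_ege1 // ler1n.
    by lra.
  have -> : 256 = 2 ^+ 8 :> R by rewrite -natrX.
  by rewrite lnM ?posrE ?exprn_gt0 // !lnXn // !mulr_natl.
move=> Gamma [S genS] [|[|k]] tau tauA; try by case: tauA.
have [beta beta1 pieces] := anosov_pieces genS tauA.
exists beta; split=> // -[|[|n]] rho _ rhoA L dL; try by case: rhoA.
exact: Dil_bound genS tauA beta1 pieces L dL.
Qed.
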